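(* Let $S(t)$ be an inverse subordinator, $T>0$, $Z_0>0$, $r\ge0$, $\sigma>0$, and let $f:[0,\infty)\to[0,\infty)$ be a continuous payoff function for which there is $c>0$ with $f(x)\le c|x|$ for all $x$. For $\tau>0$ and $n\in\mathbb N$ let $u_n=e^{\sigma\sqrt{\tau/n}}$, $d_n=1/u_n$, $R_n=e^{r\tau/n}$, $q_n=(R_n-d_n)/(u_n-d_n)$, and define the binomial (CRR) price $$V_n(\tau)=\frac{1}{R_n^{\,n}}\sum_{j=0}^n\binom{n}{j}q_n^j(1-q_n)^{n-j}f\big(Z_0u_n^jd_n^{\,n-j}\big).$$ Define the subordinated binomial price $C^{bin}_S(T)=\mathbb{E}\,V_n(S(T))$ and the subordinated Black–Scholes price $C_S(T)=\mathbb{E}\,V(S(T))$, where $V(\tau)=e^{-r\tau}\,\mathbb{E}\,f\big(Z_0\exp((r-\sigma^2/2)\tau+\sigma\sqrt\tau N)\big)$ with $N\sim\mathcal N(0,1)$ is the classical Black–Scholes price of the European option with payoff $f$ and maturity $\tau$. Then $$\lim_{n\to\infty}C^{bin}_S(T)=C_S(T).$$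
   Context: Inverse subordinator: let $\nu$ be a Lévy measure on $(0,\infty)$ with $\int_0^\infty \min(1,x)\,\nu(dx)<\infty$ and $\nu(0,\infty)=\infty$, $\psi(u)=\int_0^\infty(1-e^{-ux})\,\nu(dx)$, $U_\psi$ the subordinator with $\mathbb{E}e^{-uU_\psi(t)}=e^{-t\psi(u)}$, and $S(t)=\inf\{\tau>0:U_\psi(\tau)>t\}$. In the expectations $\mathbb{E}\,V_n(S(T))$ and $\mathbb{E}\,V(S(T))$ the tree parameters are evaluated at the random time $\tau=S(T)$ (the binomial tree is run over a randomized time horizon). $C_S(T)$ is the fair price of the European option with payoff $f$ in the subordinated Black–Scholes model with underlying $Z_0\exp(\mu S(t)+\sigma B(S(t)))$. *)

(* Defs.v *)
From HB Require Import structures.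
From mathcomp Require Import all_boot all_order all_algebra.
From mathcomp Require Import all_classical all_reals all_analysis.
Set Implicit Arguments. Unset Strict Implicit. Unset Printing Implicit Defensive.
Import Order.TTheory GRing.Theory Num.Def Num.Theory.
Import numFieldNormedType.Exports.
Local Open Scope classical_set_scope.
Local Open Scope ring_scope.

Section Defs.
Context {R : realType}.

Definition levy_measure_inf (nu : {measure set R -> \bar R}) : Prop :=
  [/\ nu `]-oo, 0%R]%classic = 0%E,
      (\int[nu]_(x in `]0%R, +oo[%classic) (Num.min 1 x)%:E < +oo)%E &
      nu `]0%R, +oo[%classic = +oo%E].

(** Laplace exponent psi(u) = int_0^oo (1 - e^{-ux}) nu(dx) (finite under the
    hypotheses; we take its real value). *)
Definition laplace_exponent (nu : {measure set R -> \bar R}) (u : R) : R :=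
  fine (\int[nu]_(x in `]0%R, +oo[%classic) (1 - expR (- (u * x)))%:E).

Definition Ex d (Omega : measurableType d) (P : probability Omega R)
  (X : Omega -> R) : \bar R := \int[P]_w (X w)%:E.

Definition independent_increments d (Omega : measurableType d)
  (P : probability Omega R) (U : R -> Omega -> R) : Prop :=
  forall (n : nat) (t : nat -> R) (B : nat -> set R),
    0 <= t 0%N -> (forall i, t i <= t i.+1) ->
    (forall i, measurable (B i)) ->
    P (\bigcap_(i in `I_n) [set w | B i (U (t i.+1) w - U (t i) w)]) =
    (\prod_(i < n) P [set w | B i (U (t i.+1) w - U (t i) w)%R])%E.

Definition is_subordinator d (Omega : measurableType d)
  (P : probability Omega R) (nu : {measure set R -> \bar R})
  (U : R -> Omega -> R) : Prop :=
  (forall w, U 0 w = 0) /\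
      (forall w s t, 0 <= s -> s <= t -> U s w <= U t w) /\
      (forall w t, 0 <= t -> (U ^~ w) @ at_right t --> U t w) /\
      (forall t, 0 <= t -> measurable_fun setT (U t)) /\
      independent_increments P U /\
      (forall s t u, 0 <= s -> 0 <= t -> 0 <= u ->
         Ex P (fun w => expR (- (u * (U (t + s) w - U s w)))) =
         (expR (- (t * laplace_exponent nu u)))%:E).

Definition inverse_subordinator d (Omega : measurableType d)
  (U : R -> Omega -> R) (t : R) (w : Omega) : R :=
  inf [set tau | 0 < tau /\ t < U tau w].

Definition crr_price (f : R -> R) (Z0 r sigma : R) (n : nat) (tau : R) : R :=
  let un := expR (sigma * Num.sqrt (tau / n%:R)) in
  let dn := un^-1 in
  let Rn := expR (r * tau / n%:R) in
  let qn := (Rn - dn) / (un - dn) in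
  (Rn ^+ n)^-1 *
  \sum_(j < n.+1) ('C(n, j))%:R * qn ^+ j * (1 - qn) ^+ (n - j) *
                  f (Z0 * un ^+ j * dn ^+ (n - j)).

Definition bs_price (f : R -> R) (Z0 r sigma tau : R) : \bar R :=
  ((expR (- (r * tau)))%:E *
   \int[normal_prob 0 1]_x
     (f (Z0 * expR ((r - sigma ^+ 2 / 2) * tau + sigma * Num.sqrt tau * x)))%:E)%E.

End Defs.

(* Main.v *)
Require Import Defs.
From HB Require Import structures.
From mathcomp Require Import all_boot all_order all_algebra.
From mathcomp Require Import all_classical all_reals all_analysis.
From mathcomp Require Import measurable_realfun.
From mathcomp Require Import ring lra.
Set Implicit Arguments. Unset Strict Implicit. Unset Printing Implicit Defensive.
Import Order.TTheory GRing.Theory Num.Def Num.Theory.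
Import numFieldNormedType.Exports.
Local Open Scope classical_set_scope.
Local Open Scope ring_scope.

(** For a fixed maturity, V_n tends to V by a central limit theorem proved with
    Stein's method: for h continuous with compact support, the equation
    s'(x) - x s(x) = h(x) - E h(N) has a solution s with s, s' vanishing at
    infinity, and the binomial law satisfies the discrete analogue of
    E[N s(N)] = E[s'(N)] up to an error controlled by the modulus of continuity
    of s' and by sqrt n (2 q_n - 1) - (r - sigma^2 / 2) sqrt tau / sigma.
    Compact support is then removed by the exact matching of means
    E_n[stock] = Z_0 R_n^n = E[stock], applied to both f and c * stock - f.

    The passage to the random maturity S(T) is by dominated convergence.  When
    q_n > 1 the binomial weights are signed, so V_n is not bounded by c Z_0;
    however |V_n(tau)| <= c Z_0 e^(a tau) for some a independent of n, and S(T)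
    has all exponential moments: S(T) > t forces U(t) <= T, an event of
    probability at most e^(uT - t psi(u)), and psi(u) tends to infinity because
    nu has infinite mass. *)

(** * Integrals against the normal law *)

(** The Radon-Nikodym derivative of the normal law equals the density almost everywhere, since both
    have the same integral over every measurable set. *)
Lemma ge0_integral_normal_prob (R : realType) (m s : R) (f : R -> \bar R)
    (E : set R) :
  (forall x, 0 <= f x)%E -> measurable E -> measurable_fun E f ->
  (\int[normal_prob m s]_(x in E) f x =
   \int[lebesgue_measure]_(x in E) (f x * (normal_pdf m s x)%:E))%E.
Proof.
move=> f0 mE mf.
have dom := @normal_prob_dominates R m s.
rewrite -(Radon_Nikodym_SigmaFinite.change_of_variables dom)//.
have mRN D : measurable D ->
    measurable_fun D (Radon_Nikodym_SigmaFinite.f (normal_prob m s)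
      (@lebesgue_measure R)).
  move=> mD; apply: (measurable_int (@lebesgue_measure R)).
  apply: (integrableS measurableT) => //.
  exact: Radon_Nikodym_SigmaFinite.f_integrable.
apply: ae_eq_integral => //.
- by apply: emeasurable_funM => //; exact: mRN.
- apply: emeasurable_funM => //; apply/measurableT_comp => //=.
  by apply/measurable_funTS; exact: measurable_normal_pdf.
- apply: ae_eqe_mul2l => /=; apply: integral_ae_eq => //=.
  + apply: (integrableS measurableT) => //.
    exact: Radon_Nikodym_SigmaFinite.f_integrable.
  + by apply/measurable_funTS/measurableT_comp => //; exact: measurable_normal_pdf.
  + by move=> D DE mD; rewrite -Radon_Nikodym_SigmaFinite.f_integral.
Qed.

Lemma integral_normal_prob_expR (R : realType) (s : R) :
  (\int[normal_prob 0 1]_x (expR (s * x))%:E = (expR (s ^+ 2 / 2))%:E)%E.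
Proof.
have mE : measurable_fun [set: R] (fun x => expR (s * x)).
  apply: measurableT_comp => //; exact: measurable_funM.
rewrite ge0_integral_normal_prob//=; last exact/measurable_EFinP.
(* Completing the square: [e^(s x)] times the standard density is [e^(s^2/2)] times the density with
   mean [s]. *)
transitivity (\int[lebesgue_measure]_x
    ((expR (s ^+ 2 / 2))%:E * (normal_pdf s 1 x)%:E))%E.
  apply: eq_integral => x _; rewrite -!EFinM; congr EFin.
  rewrite !normal_pdfE ?oner_neq0//= /normal_fun mulrCA [RHS]mulrCA.
  by congr (_ * _); rewrite -!expRD; congr expR; field.
rewrite integralZl//; first by rewrite integral_normal_pdf mule1.
exact: integrable_normal_pdf.
Qed.

(** * Stein's equation *)

Definition vanishing_at_infinity (R : realType) (g : R -> R) :=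
  forall e, 0 < e -> exists M, forall x, M <= `|x| -> `|g x| <= e.

Lemma vanishing_bounded (R : realType) (g : R -> R) :
  continuous g -> vanishing_at_infinity g -> exists B, forall x, `|g x| <= B.
Proof.
move=> cg /(_ 1 ltr01) [M gM].
pose a := Num.max M 0; have a0 : 0 <= a by rewrite le_max lexx orbT.
have aa : - a <= a by lra.
have [|c _ hc] := @EVT_max R (fun x => `|g x|) _ _ aa.
  by apply: continuous_subspaceT => x; apply: cvg_norm; exact: cg.
exists (Num.max 1 `|g c|) => x; rewrite le_max.
have [ax|xa] := leP a `|x|; last first.
  by rewrite hc ?orbT// in_itv/= -ler_norml ltW.
by rewrite gM// (le_trans _ ax)// le_max lexx.
Qed.

(** Compactness handles [x] in [[-(M+1), M+1]]. For [x] outside, the choice [r < 1] keeps [y] beyond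
    [M], where both values are at most [e / 2]. *)
Lemma vanishing_uniformly_continuous (R : realType) (g : R -> R) :
  continuous g -> vanishing_at_infinity g ->
  forall e, 0 < e -> exists2 r, 0 < r &
    forall x y, `|x - y| <= r -> `|g x - g y| <= e.
Proof.
move=> cg vg e e0; have e20 : 0 < e / 2 by rewrite divr_gt0.
have [M gM] := vg _ e20.
pose P (r x : R) := forall y, `|x - y| <= r -> `|g x - g y| <= e.
have loc x : exists2 r, 0 < r & forall y, `|x - y| < r -> `|g x - g y| < e / 2.
  by have /cvgr_dist_lt /(_ _ e20) /nbhs_ballP[r r0 hr] := cg x; exists r.
have cov : forall x, `[- (M + 1), (M + 1)]%classic x ->
    \forall x' \near x & i \near 0^'+, P i x'.
  move=> x _; have [r r0 hr] := loc x; have r20 : 0 < r / 2 by rewrite divr_gt0.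
  exists (ball x (r / 2), [set i | i < r / 2]) => /=.
    split; first exact: nbhsx_ballx.
    exact: nbhs_right_lt.
  move=> [x' i] /= [xx' ir] y x'y.
  have h1 : `|g x - g x'| < e / 2.
    by apply: hr; rewrite (lt_trans xx')//; lra.
  have h2 : `|g x - g y| < e / 2.
    apply: hr; rewrite (le_lt_trans (ler_distD x' _ _))//.
    by have : `|x - x'| < r / 2 := xx'; lra.
  rewrite (le_trans (ler_distD (g x) _ _))// (distrC (g x')); lra.
have /compact_near_coveringP := @segment_compact R (- (M + 1)) (M + 1).
move=> /(_ _ (0^'+) P _ cov) near_r.
have [r [r0 r1 hr]] : exists r, [/\ 0 < r, r < 1 &
    `[- (M + 1), (M + 1)]%classic `<=` P r].
  near (0:R)^'+ => r; exists r; split; near: r.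
  - exact: nbhs_right_gt.
  - exact: nbhs_right_lt.
  - exact: near_r.
exists r => // x y xy.
have [xM|Mx] := leP `|x| (M + 1).
  by apply: hr => //=; rewrite in_itv/= -ler_norml.
have gx : `|g x| <= e / 2 by apply: gM; lra.
have gy : `|g y| <= e / 2.
  apply: gM; have := ler_distD 0 x y; have := ler_distD y x 0.
  by rewrite !subr0; lra.
by rewrite (le_trans (ler_normB _ _))//; lra.
Unshelve. all: by end_near. Qed.

(** A nondecreasing function stays below its limit at infinity. *)
Lemma nondecreasing_cvg0_le0 (R : realType) (G dG : R -> R) (K : R) :
  (forall x, K <= x -> is_derive x 1 G (dG x)) ->
  (forall x, K <= x -> 0 <= dG x) ->
  G x @[x --> +oo] --> (0:R) -> forall x, K <= x -> G x <= 0.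
Proof.
move=> dGE dG0 G0 x Kx; rewrite leNgt; apply/negP => Gx.
near (pinfty_nbhs R) => y.
have xy : x <= y by near: y; exact: (nbhs_pinfty_ge (num_real x)).
have Gy : G y < G x by near: y; exact: (cvgr_lt _ G0 _ Gx).
have [z| |c] := @MVT_segment R G dG x y xy.
- by rewrite in_itv/= => /andP[xz _]; apply: dGE; rewrite (le_trans Kx)// ltW.
- apply: derivable_within_continuous => z; rewrite in_itv/= => /andP[xz _].
  by have [] := dGE z (le_trans Kx xz).
rewrite in_itv/= => /andP[xc _] GE.
have : 0 <= G y - G x.
  by rewrite GE mulr_ge0 ?subr_ge0// dG0// (le_trans Kx).
by rewrite subr_ge0 leNgt Gy.
Unshelve. all: by end_near. Qed.

Lemma normal_pdf01E (R : realType) (x : R) :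
  normal_pdf 0 1 x = normal_peak 1 * expR (- (x ^+ 2 / 2)).
Proof.
by rewrite normal_pdfE ?oner_neq0//= /normal_fun subr0 expr1n mulNr.
Qed.

Lemma normal_pdf01_gt0 (R : realType) (x : R) : 0 < normal_pdf 0 1 x.
Proof.
by rewrite normal_pdf01E mulr_gt0 ?expR_gt0// normal_peak_gt0// oner_neq0.
Qed.

Lemma is_derive_normal_pdf01 (R : realType) (x : R) :
  is_derive x 1 (normal_pdf 0 1) (- x * normal_pdf 0 1 x).
Proof.
have -> : normal_pdf 0 1 = (normal_peak 1 : R) *: (fun y : R => expR (- (y ^+ 2 / 2))).
  by apply/funext => y; rewrite normal_pdf01E.
have d1 : is_derive x 1 (fun y : R => - (y ^+ 2 / 2)) (- x).
  have -> : (fun y : R => - (y ^+ 2 / 2)) = (- 2^-1) *: (id ^+ 2 : R -> R).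
    by apply/funext => y; rewrite !fctE /GRing.scale/=; field.
  apply: is_derive_eq; rewrite /GRing.scale/=; by field.
have d2 := is_derive1_comp (is_derive_expR _) d1.
apply: is_derive_eq; rewrite !fctE /GRing.scale/=; ring.
Qed.

Lemma cvg0_of_le_inv (R : realType) (G : R -> R) (C K : R) :
  0 < K -> (forall x, K <= x -> `|G x| <= C / x) ->
  G x @[x --> +oo] --> (0:R).
Proof.
move=> K0 GC; apply/cvgr0Pnorm_le => e e0.
have C0 : 0 <= C.
  have := le_trans (normr_ge0 _) (GC K (lexx K)).
  by rewrite pmulr_lge0// invr_gt0.
near=> x.
have Kx : K <= x by near: x; exact: (nbhs_pinfty_ge (num_real K)).
have Cx : C / e <= x by near: x; exact: (nbhs_pinfty_ge (num_real _)).
have x0 : 0 < x by exact: lt_le_trans Kx.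
rewrite (le_trans (GC x Kx))// ler_pdivrMr// mulrC.
by move: Cx; rewrite ler_pdivrMr.
Unshelve. all: by end_near. Qed.

(** Mills' bounds for [A] times the Gaussian right tail. The differences lower bound minus [F] and
    [F] minus upper bound have explicit nonnegative derivatives and tend to 0, so both are
    nonpositive. Describing [F] by its derivative and limit lets the lemma apply to a reflected left
    tail as well. *)
Lemma mills_bounds (R : realType) (F : R -> R) (A K : R) :
  0 < K -> 0 <= A ->
  (forall x, K <= x -> is_derive x 1 F (- A * normal_pdf 0 1 x)) ->
  F x @[x --> +oo] --> (0:R) -> forall x, K <= x ->
  A * x / (x ^+ 2 + 1) * normal_pdf 0 1 x <= F x <= A / x * normal_pdf 0 1 x.
Proof.
move=> K0 A0 dF F0.
pose phi : R -> R := normal_pdf 0 1.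
have phi0 x : 0 < phi x by exact: normal_pdf01_gt0.
have phi1 x : phi x <= normal_peak 1 by apply: normal_pdf_ub; rewrite oner_neq0.
pose u x : R := A / x * phi x; pose l x : R := A * x / (x ^+ 2 + 1) * phi x.
have x2 (x : R) : 0 < x ^+ 2 + 1 by rewrite ltr_wpDl// sqr_ge0.
have l0 x : 0 < x -> 0 <= l x.
  by move=> x0; rewrite !mulr_ge0 ?invr_ge0// ltW.
have lu x : 0 < x -> l x <= u x.
  move=> x0; rewrite ler_pM2r// ler_pdivlMr//.
  rewrite mulrAC ler_pdivrMr// -mulrA ler_wpM2l//.
  by rewrite -expr2 lerDl.
have uC x : 0 < x -> u x <= A * normal_peak 1 / x.
  by move=> x0; rewrite /u mulrAC ler_pM2r ?invr_gt0// ler_wpM2l.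
have ucvg : u x @[x --> +oo] --> (0:R).
  apply: (@cvg0_of_le_inv _ _ (A * normal_peak 1) K) => // x Kx.
  have x0 := lt_le_trans K0 Kx.
  by rewrite ger0_norm ?uC// (le_trans (l0 x x0))// lu.
have lcvg : l x @[x --> +oo] --> (0:R).
  apply: (@cvg0_of_le_inv _ _ (A * normal_peak 1) K) => // x Kx.
  have x0 := lt_le_trans K0 Kx.
  by rewrite ger0_norm ?l0// (le_trans (lu x x0))// uC.
have dphi (x : R) : is_derive x 1 phi (- x * phi x) by exact: is_derive_normal_pdf01.
have du (x : R) : 0 < x -> is_derive x 1 u (- A * phi x - A / x ^+ 2 * phi x).
  move=> x0; have dV := @is_deriveV _ (@id R) x 1 1 (lt0r_neq0 x0) _.
  have -> : u = A *: ((fun y => y^-1) * phi).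
    by apply/funext => y; exact: esym (mulrA _ _ _).
  apply: is_derive_eq; rewrite /GRing.scale/=; rewrite ?(mulrfctE _ _); field.
  by rewrite gt_eqF.
have dl (x : R) : 0 < x -> is_derive x 1 l
    (- A * phi x + 2 * A / (x ^+ 2 + 1) ^+ 2 * phi x).
  move=> x0.
  have d1 : is_derive x 1 (fun y : R => y ^+ 2 + 1) (2 * x).
    have -> : (fun y : R => y ^+ 2 + 1) = (id ^+ 2 + cst 1 : R -> R).
      by apply/funext => y; rewrite !fctE.
    by apply: is_derive_eq; rewrite /GRing.scale/=; ring.
  have dV := @is_deriveV _ _ x _ 1 (lt0r_neq0 (x2 x)) d1.
  have -> : l = A *: (id * (fun y => (y ^+ 2 + 1)^-1) * phi).
    by apply/funext => y; rewrite /l -!mulrA.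
  apply: is_derive_eq; rewrite /GRing.scale/=; rewrite ?(mulrfctE _ _); field.
  by rewrite gt_eqF.
move=> x Kx; apply/andP; split; rewrite -subr_le0.
- apply: (@nondecreasing_cvg0_le0 _ (l - F)
    (fun y => 2 * A / (y ^+ 2 + 1) ^+ 2 * phi y) K _ _ _ x Kx).
  + move=> y Ky; have dlF := is_deriveB (dl y (lt_le_trans K0 Ky)) (dF y Ky).
    by apply: (is_derive_eq dlF); rewrite /phi; ring.
  + by move=> y Ky; rewrite !mulr_ge0 ?invr_ge0 ?exprn_ge0// ltW.
  + by rewrite -(subr0 0); exact: cvgB.
- apply: (@nondecreasing_cvg0_le0 _ (F - u)
    (fun y => A / y ^+ 2 * phi y) K _ _ _ x Kx).
  + move=> y Ky; have dFu := is_deriveB (dF y Ky) (du y (lt_le_trans K0 Ky)).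
    by apply: (is_derive_eq dFu); rewrite /phi; ring.
  + move=> y Ky; rewrite !mulr_ge0 ?invr_ge0 ?exprn_ge0//; last exact: ltW.
    by rewrite ltW// (lt_le_trans K0).
  + by rewrite -(subr0 0); exact: cvgB.
Qed.

(** The identity as a random variable: under the normal law its distribution function is that of the
    law, so the limits of distribution functions at infinity give the tail limits. *)
Definition real_id {R : realType} : measurableTypeR R -> R := idfun.

HB.instance Definition _ (R : realType) := @isMeasurableFun.Build _ _ _ _
  (@real_id R) (@measurable_id _ (measurableTypeR R) setT).

Lemma normal_prob_left_tail (R : realType) :
  fine (normal_prob (0:R) 1 `]-oo, x]) @[x --> -oo] --> (0:R).
Proof.
exact: fine_cvg (@cvg_cdfNy0 _ _ R (normal_prob 0 1) real_id).
Qed.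

Lemma normal_prob_right_tail (R : realType) :
  fine (normal_prob (0:R) 1 `]x, +oo[) @[x --> +oo] --> (0:R).
Proof.
exact: fine_cvg (@cvg_ccdfy0 _ _ R (normal_prob 0 1) real_id).
Qed.

Section stein_equation.
Variables (R : realType) (h : R -> R) (K A : R).
Hypotheses (K0 : 0 < K) (ch : continuous h) (h0 : forall x, 0 <= h x).
Hypothesis hK : forall x, K <= `|x| -> h x = 0.
Hypothesis hA : (\int[normal_prob 0 1]_x (h x)%:E = A%:E)%E.

Local Notation mu := (@lebesgue_measure R).
Local Notation phi := (normal_pdf 0 1 : R -> R).
Let g x := (h x - A) * phi x.
(** Numerator of Stein's solution: as [phi' = - x phi], the quotient [F / phi] has derivative
    [x F / phi + h - A]. *)
Let F x := (\int[mu]_(t in `]-oo, x]) g t)%R.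

Let phi0 x : 0 < phi x. Proof. exact: normal_pdf01_gt0. Qed.

Let A0 : 0 <= A.
Proof. by rewrite -lee_fin -hA; apply: integral_ge0 => x _; rewrite lee_fin. Qed.

Let mphi : measurable_fun [set: R] phi.
Proof. exact: measurable_normal_pdf. Qed.

Let mh : measurable_fun [set: R] h.
Proof. exact: continuous_measurable_fun. Qed.

Let int_phi D : measurable D -> mu.-integrable D (EFin \o phi).
Proof.
by move=> mD; apply: integrableS (integrable_normal_pdf _ _) => //; exact: subsetT.
Qed.

Let int_g : mu.-integrable setT (EFin \o g).
Proof.
have [B hB] : exists B, forall x, `|h x| <= B.
  apply: vanishing_bounded => // e e0; exists K => x Kx.
  by rewrite hK// normr0 ltW.
apply: (@le_integrable _ _ _ mu _ _ _ (fun x => ((B + A) * phi x)%:E)) => //.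
- by apply/measurable_EFinP; apply: measurable_funM => //; exact: measurable_funB.
- move=> x _; rewrite lee_fin !normrM; apply: ler_wpM2r => //.
  rewrite (le_trans (ler_normB _ _))// (ger0_norm A0) [leRHS]ger0_norm ?lerD2r//.
  by rewrite addr_ge0// (le_trans (normr_ge0 _) (hB 0)).
- rewrite (_ : (fun x => _) = (fun x => (B + A)%:E * (phi x)%:E)%E) //.
  by apply: integrableZl => //; exact: int_phi.
Qed.

Let int_gD D : measurable D -> mu.-integrable D (EFin \o g).
Proof. by move=> mD; apply: integrableS int_g => //; exact: subsetT. Qed.

Let cg : continuous g.
Proof.
move=> x; apply: cvgM; first by apply: cvgB; [exact: ch|exact: cvg_cst].
by apply: continuous_normal_pdf; rewrite oner_neq0.
Qed.

Let dF (x : R) : is_derive x 1 F (g x).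
Proof.
have xx1 : x < x + 1 by rewrite ltrDl.
have [] := @continuous_FTC1 R g -oo%O x _ xx1 (int_gD _) (ltNyr _) (@cg x) => //.
move=> dFx F'x.
by split => //; rewrite -F'x derive1E.
Qed.

(** Holds because [A] is the normal mean of [h]; it turns [F] into minus an integral over the right
    half line. *)
Let total : (\int[mu]_t g t)%R = 0.
Proof.
have int_hphi : mu.-integrable setT (EFin \o (h \* phi)).
  have -> : EFin \o (h \* phi) = (EFin \o g) \+ (fun x => (A * phi x)%:E)%E.
    by apply/funext => x; rewrite /= -EFinD /g mulrBl subrK.
  apply: integrableD => //.
  rewrite (_ : (fun x => _) = (fun x => A%:E * (phi x)%:E)%E) //.
  by apply: integrableZl => //; exact: int_phi.
have int_Aphi : mu.-integrable setT (EFin \o (fun x => A * phi x)).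
  rewrite (_ : _ \o _ = (fun x => A%:E * (phi x)%:E)%E) //.
  by apply: integrableZl => //; exact: int_phi.
under eq_Rintegral do rewrite /g mulrBl.
rewrite RintegralB// RintegralZl//; last exact: int_phi.
rewrite /Rintegral integral_normal_pdf/= mulr1.
have := hA; rewrite ge0_integral_normal_prob//=; last exact/measurable_EFinP.
by under [in X in _ -> X]eq_integral do rewrite EFinM; move=> ->; rewrite /= subrr.
Qed.

Let tail D : measurable D -> (forall x, D x -> h x = 0) ->
  (\int[mu]_(t in D) g t)%R = - A * fine (normal_prob 0 1 D).
Proof.
move=> mD hD; rewrite /normal_prob -/(Rintegral mu D phi).
rewrite -RintegralZl//; last exact: int_phi.
by apply: eq_Rintegral => x /[!inE] Dx; rewrite /g hD// sub0r.
Qed.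

Let F_left (x : R) : x <= - K -> F x = - A * fine (normal_prob 0 1 `]-oo, x]).
Proof.
move=> xK; apply: tail => // y/=; rewrite in_itv/= => yx.
by apply: hK; rewrite ler_normr; apply/orP; right; lra.
Qed.

Let F_right (x : R) : K <= x -> F x = A * fine (normal_prob 0 1 `]x, +oo[).
Proof.
move=> Kx.
have := @Rintegral_itvB R g -oo%O +oo%O x.
rewrite set_itvE total => /(_ int_g isT isT).
rewrite -/(F x) tail//; first by lra.
move=> y/=; rewrite in_itv/= andbT => xy.
by apply: hK; rewrite ler_normr; apply/orP; left; lra.
Qed.

Let F_at_pinfty : F x @[x --> +oo] --> (0:R).
Proof.
have : A * fine (normal_prob (0:R) 1 `]x, +oo[) @[x --> +oo] --> A * 0.
  by apply: cvgM; [exact: cvg_cst|exact: normal_prob_right_tail].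
rewrite mulr0; apply: cvg_trans; apply: near_eq_cvg; near=> x; rewrite F_right//.
Unshelve. all: by end_near. Qed.

Let F_at_ninfty : F x @[x --> -oo] --> (0:R).
Proof.
have : - A * fine (normal_prob (0:R) 1 `]-oo, x]) @[x --> -oo] --> - A * 0.
  by apply: cvgM; [exact: cvg_cst|exact: normal_prob_left_tail].
rewrite mulr0; apply: cvg_trans; apply: near_eq_cvg; near=> x; rewrite F_left//.
Unshelve. all: by end_near. Qed.

(* As [g] has total mass 0, [F] equals [A] times the right normal tail on
   [K, +oo[ and [- A] times the left one on ]-oo, - K], so Mills' bounds make
   both [f] and [f'] vanish at infinity. *)
Let f x := F x / phi x.
Let f' x := x * f x + h x - A.

Let bounds x : K <= `|x| -> `|f x| <= A / `|x| /\ `|f' x| <= A / `|x|.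
Proof.
have main (G : R -> R) : (forall y, K <= y -> is_derive y 1 G (- A * phi y)) ->
    G y @[y --> +oo] --> (0:R) -> forall y, K <= y ->
    `|G y / phi y| <= A / y /\ `|y * (G y / phi y) - A| <= A / y.
  move=> dG G0 y Ky; have /andP[lG uG] := mills_bounds K0 A0 dG G0 Ky.
  have y0 : 0 < y := lt_le_trans K0 Ky.
  rewrite -ler_pdivlMr// in lG; rewrite -ler_pdivrMr// in uG.
  set m := G y / phi y in lG uG *.
  have y2 : 0 < y ^+ 2 + 1 by rewrite ltr_wpDl// sqr_ge0.
  have m0 : 0 <= m by rewrite (le_trans _ lG)// !mulr_ge0 ?invr_ge0// ltW.
  split; first by rewrite ger0_norm.
  have ymA : y * m <= A by rewrite mulrC -ler_pdivlMr.
  rewrite distrC ger0_norm ?subr_ge0//.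
  (* The lower Mills bound gives [A - y m <= A / (y^2 + 1)], and [y <= y^2 + 1]. *)
  rewrite (@le_trans _ _ (A / (y ^+ 2 + 1)))//.
    have : y * (A * y / (y ^+ 2 + 1)) <= y * m by rewrite ler_wpM2l// ltW.
    have -> : y * (A * y / (y ^+ 2 + 1)) = A - A / (y ^+ 2 + 1).
      by field; rewrite gt_eqF.
    lra.
  rewrite ler_wpM2l// lef_pV2 ?posrE//; nra.
move=> Kx; rewrite /f' (hK Kx) addr0 /f.
have [x0|x0] := leP 0 x.
  rewrite ger0_norm// in Kx *; apply: main => // y Ky.
  apply: is_derive_eq (dF y) _.
  by rewrite /g hK ?sub0r// ger0_norm// (le_trans _ Ky)// ltW.
rewrite ltr0_norm// in Kx *.
(* The left half line reduces to the right one by reflection, [phi] being even. *)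
have [||mF mF'] := main (fun y => - F (- y)) _ _ (- x) Kx.
- move=> y Ky.
  have dNF := is_deriveN (is_derive1_comp (dF (- y)) (is_deriveNid y 1)).
  apply: (is_derive_eq dNF); rewrite /g hK ?normrN; last first.
    by rewrite ger0_norm// (le_trans _ Ky)// ltW.
  by rewrite !normal_pdf01E sqrrN; ring.
- by rewrite -oppr0; apply: cvgN; apply: (iffLR (cvgNy_compNP F _)).
have phiN : phi (- x) = phi x by rewrite !normal_pdf01E sqrrN.
rewrite opprK phiN in mF mF'; split.
  by rewrite -[X in X <= _]normrN -mulNr.
by rewrite [- F x / _]mulNr mulrNN in mF'.
Qed.

Let vanish (k : R -> R) : (forall x, K <= `|x| -> `|k x| <= A / `|x|) ->
  vanishing_at_infinity k.
Proof.
move=> hk e e0; exists (Num.max K (A / e)) => x; rewrite ge_max => /andP[Kx Aex].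
rewrite (le_trans (hk _ Kx))// ler_pdivrMr ?(lt_le_trans K0)// mulrC.
by rewrite -ler_pdivrMr.
Qed.

Let df (x : R) : is_derive x 1 f (f' x).
Proof.
have dV := @is_deriveV _ _ x _ 1 (lt0r_neq0 (phi0 x)) (is_derive_normal_pdf01 x).
have dFV := is_deriveM (dF x) dV.
apply: (is_derive_eq dFV); rewrite /GRing.scale/= /f' /f /g.
by field; rewrite gt_eqF.
Qed.

Let cf : continuous f.
Proof. by move=> x; apply/differentiable_continuous/derivable1_diffP; have [] := df x. Qed.

Let cf' : continuous f'.
Proof.
move=> x; apply: cvgB; last exact: cvg_cst.
apply: cvgD; last exact: ch.
by apply: cvgM; [exact: cvg_id|exact: cf].
Qed.

(** The uniform modulus of [s'] on the whole line is what later allows mean-value points to be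
    replaced by neighbouring grid points; it follows from the decay of [s'] at infinity. *)
Lemma stein_solution : exists s s' : R -> R,
  [/\ forall x : R, is_derive x 1 s (s' x),
      forall x, s' x = x * s x + h x - A,
      exists B, forall x, `|s x| <= B,
      exists B, forall x, `|s' x| <= B &
      forall e, 0 < e -> exists2 r, 0 < r &
        forall x y, `|x - y| <= r -> `|s' x - s' y| <= e].
Proof.
exists f, f'; split => //.
- by apply: vanishing_bounded => //; apply: vanish => x /bounds[].
- by apply: vanishing_bounded => //; apply: vanish => x /bounds[].
- by apply: vanishing_uniformly_continuous => //; apply: vanish => x /bounds[].
Qed.

End stein_equation.

(** * Binomial means *)

Section binomial_mean.
Variables (R : realType) (q : R).
Implicit Types (n k : nat) (F G : nat -> R).

(** The parameter [q] ranges over all reals, so the algebraic identities also cover the signed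
    weights that occur when [q_n > 1]. *)
Definition binomial_mean n F : R :=
  \sum_(k < n.+1) ('C(n, k))%:R * q ^+ k * (1 - q) ^+ (n - k) * F k.

Lemma eq_binomial_mean n F G :
  (forall k, (k <= n)%N -> F k = G k) -> binomial_mean n F = binomial_mean n G.
Proof. by move=> FG; apply: eq_bigr => k _; rewrite FG// -ltnS. Qed.

Lemma binomial_meanD n F G :
  binomial_mean n (fun k => F k + G k) = binomial_mean n F + binomial_mean n G.
Proof. by rewrite -big_split/=; apply: eq_bigr => k _; rewrite mulrDr. Qed.

Lemma binomial_meanZ n c F :
  binomial_mean n (fun k => c * F k) = c * binomial_mean n F.
Proof. by rewrite mulr_sumr; apply: eq_bigr => k _; rewrite mulrCA. Qed.

Lemma binomial_meanB n F G :
  binomial_mean n (fun k => F k - G k) = binomial_mean n F - binomial_mean n G.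
Proof. by rewrite -sumrB; apply: eq_bigr => k _; rewrite mulrBr. Qed.

Lemma binomial_mean_expr n (x y : R) :
  binomial_mean n (fun k => x ^+ k * y ^+ (n - k)) = (q * x + (1 - q) * y) ^+ n.
Proof.
rewrite addrC exprDn; apply: eq_bigr => k _.
by rewrite !exprMn -mulr_natl; ring.
Qed.

Lemma binomial_mean_cst n c : binomial_mean n (fun=> c) = c.
Proof.
rewrite -[LHS]/(binomial_mean n (fun=> c)).
have -> : binomial_mean n (fun=> c) =
    binomial_mean n (fun k => c * (1 ^+ k * 1 ^+ (n - k))).
  by apply: eq_binomial_mean => k _; rewrite !expr1n !mulr1.
by rewrite binomial_meanZ binomial_mean_expr !mulr1 addrC subrK expr1n mulr1.
Qed.

(** Conditioning on one trial; on coefficients this is Pascal's rule. *)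
Lemma binomial_mean_recr n F : binomial_mean n.+1 F =
  q * binomial_mean n (fun k => F k.+1) + (1 - q) * binomial_mean n F.
Proof.
rewrite {1}/binomial_mean big_ord_recl/= !bin0 expr0 subn0 !mul1r.
under eq_bigr => k _ do
  rewrite /bump/= add1n subSS binS natrD (addrC 'C(_, _.+1)%:R) !mulrDl.
rewrite big_split/= addrCA; congr (_ + _).
  by rewrite mulr_sumr; apply: eq_bigr => k _; rewrite exprS; ring.
rewrite big_ord_recr/= bin_small// !mul0r addr0.
rewrite [in RHS]/binomial_mean big_ord_recl/= bin0 expr0 subn0 !mul1r.
rewrite mulrDr mulrA -exprS mulr_sumr; congr (_ + _).
apply: eq_bigr => k _; rewrite /bump/= add1n.
by rewrite -(subnSK (ltn_ord k)) !exprS; ring.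
Qed.

(* Binomial integration by parts, the discrete form of E[N s(N)] = E[s'(N)]. *)
Lemma binomial_mean_stein n F :
  binomial_mean n.+1 (fun k => (k%:R - n.+1%:R * q) * F k) =
  n.+1%:R * q * (1 - q) * binomial_mean n (fun k => F k.+1 - F k).
Proof.
have -> : binomial_mean n.+1 (fun k => (k%:R - n.+1%:R * q) * F k) =
    binomial_mean n.+1 (fun k => k%:R * F k) - n.+1%:R * q * binomial_mean n.+1 F.
  rewrite -binomial_meanZ -binomial_meanB.
  by apply: eq_binomial_mean => k _; ring.
(* Size biasing, from the absorption identity [k C(n+1, k) = (n+1) C(n, k-1)]. *)
have -> : binomial_mean n.+1 (fun k => k%:R * F k) =
    n.+1%:R * q * binomial_mean n (fun k => F k.+1).
  rewrite {1}/binomial_mean big_ord_recl/= mul0r mulr0 add0r.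
  rewrite mulr_sumr; apply: eq_bigr => k _; rewrite /bump/= add1n subSS.
  have := mul_bin_diag n.+1 k => /(congr1 (fun i => i%:R : R)); rewrite !natrM => E.
  have -> : forall a b c : R, 'C(n.+1, k.+1)%:R * a * b * (k.+1%:R * c) =
    k.+1%:R * 'C(n.+1, k.+1)%:R * a * b * c by move=> *; ring.
  by rewrite -E exprS; ring.
rewrite binomial_meanB binomial_mean_recr; ring.
Qed.

Hypothesis q01 : 0 <= q <= 1.

Lemma binomial_mean_le n F G : (forall k, (k <= n)%N -> F k <= G k) ->
  binomial_mean n F <= binomial_mean n G.
Proof.
case/andP: q01 => q0 q1 FG; apply: ler_sum => k _.
apply: ler_wpM2l; last by rewrite FG// -ltnS.
by rewrite !mulr_ge0 ?exprn_ge0// subr_ge0.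
Qed.

Lemma binomial_mean_norm_le n F B :
  (forall k, (k <= n)%N -> `|F k| <= B) -> `|binomial_mean n F| <= B.
Proof.
move=> FB; rewrite ler_norml -(binomial_mean_cst n B).
rewrite -mulN1r -binomial_meanZ; apply/andP.
by split; apply: binomial_mean_le => k /FB; rewrite ler_norml ?mulN1r => /andP[].
Qed.

(** By Stein's equation the left side is the mean of [s'(w) - w s(w)]. The centred part of [w] is
    integrated by parts into increments of [s], that is, values of [s'] at points within
    [2 / sqrt n] of the grid. The second error comes from the variance
    [4 q (1 - q) = 1 - (2 q - 1)^2], the third from the mean of [w]. *)
Lemma binomial_stein_bound (h s s' : R -> R) (A B B' b e r : R) n :
  (forall x : R, is_derive x 1 s (s' x)) ->
  (forall x, s' x = x * s x + h x - A) ->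
  (forall x, `|s x| <= B) -> (forall x, `|s' x| <= B') ->
  (forall x y, `|x - y| <= r -> `|s' x - s' y| <= e) ->
  (0 < n)%N -> 2 / Num.sqrt n%:R <= r ->
  `|binomial_mean n (fun k => h ((2 * k%:R - n%:R) / Num.sqrt n%:R - b)) - A| <=
  e + (2 * q - 1) ^+ 2 * B' + `|Num.sqrt n%:R * (2 * q - 1) - b| * B.
Proof.
move=> ds sE sB s'B smod; case: n => // n _ hr.
set N := n.+1; set t : R := Num.sqrt N%:R.
have N0 : 0 < N%:R :> R by rewrite ltr0n.
have t0 : 0 < t by rewrite sqrtr_gt0.
have t2 : t ^+ 2 = N%:R by rewrite sqr_sqrtr// ltW.
pose w k : R := (2 * k%:R - N%:R) / t - b.
have wS k : w k.+1 = w k + 2 / t by rewrite /w -natr1; field; rewrite gt_eqF.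
have d0 : 0 < 2 / t by rewrite divr_gt0.
have /choice[xi xiP] : forall k, exists z, w k <= z <= w k.+1 /\
    s (w k.+1) - s (w k) = 2 / t * s' z.
  move=> k; have ww : w k < w k.+1 by rewrite wS ltrDl.
  have [|z] := @MVT R s s' _ _ ww (fun x _ => ds x).
    by apply: derivable_within_continuous => x _; have [] := ds x.
  rewrite in_itv/= => /andP[wz zw] ->; exists z; split; first by rewrite !ltW.
  by rewrite wS addrAC subrr add0r mulrC.
set E := binomial_mean.
have -> : E N (fun k => h (w k)) - A =
    E n (fun k => q * (s' (w k.+1) - s' (xi k)) + (1 - q) * (s' (w k) - s' (xi k)))
    + (2 * q - 1) ^+ 2 * E n (fun k => s' (xi k))
    - (t * (2 * q - 1) - b) * E N (fun k => s (w k)).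
  have -> : E N (fun k => h (w k)) - A = E N (fun k => s' (w k)) -
      2 / t * E N (fun k => (k%:R - N%:R * q) * s (w k)) -
      (t * (2 * q - 1) - b) * E N (fun k => s (w k)).
    rewrite -[A in LHS](binomial_mean_cst N A) -!binomial_meanZ.
    rewrite -!binomial_meanB; apply: eq_binomial_mean => k _.
    rewrite sE; move: (s (w k)) (h (w k)) => sw hw.
    by rewrite /w -t2; field; rewrite gt_eqF.
  congr (_ - _).
  rewrite {1 2}/E /N (binomial_mean_stein n (fun k => s (w k))).
  rewrite (binomial_mean_recr n (fun k => s' (w k))) -/E.
  have -> : E n (fun k => s (w k.+1) - s (w k)) = 2 / t * E n (fun k => s' (xi k)).
    by rewrite -binomial_meanZ; apply: eq_binomial_mean => k _; case: (xiP k).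
  have -> : E n (fun k => q * (s' (w k.+1) - s' (xi k)) +
        (1 - q) * (s' (w k) - s' (xi k))) =
      q * E n (fun k => s' (w k.+1)) + (1 - q) * E n (fun k => s' (w k)) -
      E n (fun k => s' (xi k)).
    rewrite -!binomial_meanZ -binomial_meanD -binomial_meanB.
    by apply: eq_binomial_mean => k _; ring.
  by rewrite -/N -t2; field; rewrite gt_eqF.
rewrite (le_trans (ler_normB _ _))// lerD//.
  rewrite (le_trans (ler_normD _ _))// lerD//.
    apply: binomial_mean_norm_le => k _; have [/andP[wx xw] _] := xiP k.
    case/andP: q01 => q0 q1.
    have -> : e = q * e + (1 - q) * e by ring.
    rewrite (le_trans (ler_normD _ _))// !normrM (ger0_norm q0).
    rewrite [`|1 - q|]ger0_norm ?subr_ge0// lerD//; apply: ler_wpM2l => //.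
    - apply: smod; rewrite ger0_norm ?subr_ge0//.
      by move: hr xw; rewrite wS -/t; lra.
    - by rewrite subr_ge0.
    - apply: smod; rewrite distrC ger0_norm ?subr_ge0//.
      by move: hr xw; rewrite wS -/t; lra.
  rewrite normrM ger0_norm ?sqr_ge0// ler_wpM2l ?sqr_ge0//.
  exact: binomial_mean_norm_le.
by rewrite normrM ler_wpM2l//; exact: binomial_mean_norm_le.
Qed.

End binomial_mean.

(** * Central limit theorem for binomial means *)

Section binomial_clt.
Variables (R : realType) (q : nat -> R) (b : R).
Hypothesis q01 : \forall n \near \oo, 0 <= q n <= 1.
Hypothesis qb : Num.sqrt n%:R * (2 * q n - 1) @[n --> \oo] --> b.

(** Subtracting the limiting mean [b] makes the limit law standard normal. *)
Let w n k : R := (2 * k%:R - n%:R) / Num.sqrt n%:R - b.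
Local Notation E n F := (binomial_mean (q n) n (fun k => F (w n k))).

Lemma cvg_invr_sqrtn : (Num.sqrt n%:R)^-1 @[n --> \oo] --> (0:R).
Proof.
have -> : (fun n : nat => (Num.sqrt n%:R)^-1) = (fun n => Num.sqrt ((n%:R : R)^-1)).
  by apply/funext => n; rewrite sqrtrV.
rewrite -(sqrtr0 R); apply: continuous_cvg; first exact: sqrt_continuous.
apply/gtr0_cvgV0; last exact: cvgr_idn.
by exists 1%N => // n /=; rewrite ltr0n.
Qed.

Lemma binomial_clt_compact (h : R -> R) (K A : R) :
  0 < K -> continuous h -> (forall x, 0 <= h x) ->
  (forall x, K <= `|x| -> h x = 0) ->
  (\int[normal_prob 0 1]_x (h x)%:E = A%:E)%E ->
  E n h @[n --> \oo] --> A.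
Proof.
move=> K0 ch h0 hK hA.
have [s [s' [ds sE [B sB] [B' sB'] unif]]] := stein_solution K0 ch h0 hK hA.
apply/cvgrPdist_le => e e0.
have e3 : 0 < e / 3 by rewrite divr_gt0.
have [r r0 smod] := unif _ e3.
have q2 : (2 * q n - 1) ^+ 2 * B' @[n --> \oo] --> (0:R).
  rewrite -(mul0r B'); apply: cvgMr_tmp.
  (* Convergence of [sqrt n (2 q_n - 1)] forces [q_n] to tend to [1/2], so the variance defect
     vanishes. *)
  have q0 : 2 * q n - 1 @[n --> \oo] --> (0:R).
    rewrite -(mulr0 b).
    apply: cvg_trans (cvgM qb cvg_invr_sqrtn); apply: near_eq_cvg.
    exists 1%N => // n /= n0; rewrite mulrAC divff ?mul1r//.
    by rewrite gt_eqF// sqrtr_gt0 ltr0n.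
  by have := cvgM q0 q0; rewrite mulr0; exact.
have q1 : `|Num.sqrt n%:R * (2 * q n - 1) - b| * B @[n --> \oo] --> (0:R).
  rewrite -(mul0r B); apply: cvgMr_tmp; rewrite -(normr0 R) -(subrr b).
  by apply: cvg_norm; apply: cvgB => //; exact: cvg_cst.
have t0 : 2 / Num.sqrt n%:R @[n --> \oo] --> (0:R).
  by rewrite -(mulr0 2); apply: cvgMl_tmp; exact: cvg_invr_sqrtn.
near=> n.
have n0 : (0 < n)%N by near: n; exists 1%N.
have qn : 0 <= q n <= 1 by near: n.
have nr : 2 / Num.sqrt n%:R <= r by near: n; exact: (cvgr_le _ t0).
rewrite distrC (le_trans (binomial_stein_bound qn b ds sE sB sB' smod n0 nr))//.
have : (2 * q n - 1) ^+ 2 * B' <= e / 3 by near: n; exact: (cvgr_le _ q2).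
have : `|Num.sqrt n%:R * (2 * q n - 1) - b| * B <= e / 3.
  by near: n; exact: (cvgr_le _ q1).
lra.
Unshelve. all: by end_near. Qed.

Let cutoff (m : nat) (x : R) := Num.max 0 (Num.min 1 (m.+1%:R - `|x|)).

Let cutoff_ge0 m x : 0 <= cutoff m x.
Proof. by rewrite /cutoff le_max lexx. Qed.

Let cutoff_le1 m x : cutoff m x <= 1.
Proof. by rewrite /cutoff ge_max ler01 ge_min lexx. Qed.

Let cutoff_out m (x : R) : m.+1%:R <= `|x| -> cutoff m x = 0.
Proof.
by move=> mx; apply/max_idPl; rewrite ge_min subr_le0 mx orbT.
Qed.

Let cutoff_in m (x : R) : `|x| <= m%:R -> cutoff m x = 1.
Proof.
move=> xm; rewrite /cutoff min_l ?max_r//.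
by rewrite -natr1; lra.
Qed.

Let cutoff_nd m p x : (m <= p)%N -> cutoff m x <= cutoff p x.
Proof.
move=> mp; rewrite /cutoff ge_max !le_max lexx/=; apply/orP; right.
by rewrite le_min !ge_min lexx/= lerD2r ler_nat ltnS mp orbT.
Qed.

Let cutoff_continuous m : continuous (cutoff m).
Proof.
have cn : continuous (fun x : R => m.+1%:R - `|x|).
  by move=> x; apply: cvgB; [exact: cvg_cst|apply: cvg_norm; exact: cvg_id].
move=> x; apply: (@continuous_max _ _ (fun=> 0) _ x); first exact: cvg_cst.
apply: (@continuous_min _ _ (fun=> 1) _ x); first exact: cvg_cst.
exact: cn.
Qed.

(** Fatou-type half of the limit theorem: truncations of [h] lie below [h], have compact support,
    and by monotone convergence recover all but [e / 2] of its integral. Mass escaping to infinity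
    can only add to the binomial mean. *)
Lemma binomial_clt_liminf (h : R -> R) (A : R) :
  continuous h -> (forall x, 0 <= h x) ->
  (\int[normal_prob 0 1]_x (h x)%:E = A%:E)%E ->
  forall e, 0 < e -> \forall n \near \oo, A - e <= E n h.
Proof.
move=> ch h0 hA e e0; pose g m x := cutoff m x * h x.
have g0 m x : 0 <= g m x by rewrite mulr_ge0.
have gh m x : g m x <= h x by rewrite ler_piMl.
have cg m : continuous (g m).
  by move=> x; apply: cvgM; [exact: cutoff_continuous|exact: ch].
have mg m : measurable_fun [set: R] (g m) by exact: continuous_measurable_fun.
have mh : measurable_fun [set: R] h by exact: continuous_measurable_fun.
have gcvg : (\int[normal_prob 0 1]_x (g m x)%:E)%E @[m --> \oo] --> A%:E.
  rewrite -hA.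
  have hlim x : limn (fun m => (g m x)%:E) = (h x)%:E.
    apply/cvg_lim => //; apply: cvg_near_cst.
    near=> m; rewrite /g cutoff_in ?mul1r//.
    by near: m; exact: nbhs_infty_ger.
  under [X in _ --> X]eq_integral => x _ do rewrite -hlim.
  apply: cvg_monotone_convergence => //.
  - by move=> m; apply/measurable_EFinP; exact: mg.
  - by move=> m x _; rewrite lee_fin.
  - by move=> x _ m p mp; rewrite lee_fin ler_wpM2r// cutoff_nd.
have gfin m : exists B, (\int[normal_prob 0 1]_x (g m x)%:E = B%:E)%E.
  have : (\int[normal_prob 0 1]_x (g m x)%:E <= A%:E)%E.
    rewrite -hA; apply: ge0_le_integral => //.
    - by move=> x _; rewrite lee_fin.
    - by apply/measurable_EFinP; exact: mg.
    - exact/measurable_EFinP.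
    - by move=> x _; rewrite lee_fin.
  have : (0 <= \int[normal_prob 0 1]_x (g m x)%:E)%E.
    by apply: integral_ge0 => x _; rewrite lee_fin.
  by case: integral => [B||] // _ _; exists B.
have [m mA] : exists m, ((A - e / 2)%:E <= \int[normal_prob 0 1]_x (g m x)%:E)%E.
  apply: contrapT => /forallNP no.
  have : (A%:E <= (A - e / 2)%:E)%E.
    by apply: cvge_le gcvg; apply: nearW => m; rewrite ltW// ltNge; exact/negP.
  by rewrite lee_fin; lra.
have [B gB] := gfin m.
rewrite gB lee_fin in mA.
have m0 : 0 < m.+1%:R :> R by rewrite ltr0n.
have gE := binomial_clt_compact m0 (cg m) (g0 m) _ gB.
have {}gE : E n (g m) @[n --> \oo] --> B.
  by apply: gE => x mx; rewrite /g cutoff_out// mul0r.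
near=> n.
have qn : 0 <= q n <= 1 by near: n.
have gn : B - e / 2 <= E n (g m).
  by near: n; apply: (cvgr_ge _ gE); lra.
apply: le_trans (binomial_mean_le qn (fun k _ => gh m (w n k))).
lra.
Unshelve. all: by end_near. Qed.

(** The lower bound is applied to [h] and to [l - h]; since the means of [l] converge to the right
    limit, the second one becomes an upper bound for [h]. *)
Theorem binomial_clt (h l : R -> R) (L : R) :
  continuous h -> continuous l -> (forall x, 0 <= h x <= l x) ->
  (\int[normal_prob 0 1]_x (l x)%:E = L%:E)%E ->
  E n l @[n --> \oo] --> L ->
  exists2 A, (\int[normal_prob 0 1]_x (h x)%:E = A%:E)%E &
    E n h @[n --> \oo] --> A.
Proof.
move=> ch cl hl lL El.
have h0 x : 0 <= h x by case/andP: (hl x).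
have lh0 x : 0 <= l x - h x by rewrite subr_ge0; case/andP: (hl x).
have mh : measurable_fun [set: R] h by exact: continuous_measurable_fun.
have clh : continuous (fun x => l x - h x) by move=> x; apply: cvgB; [exact: cl|exact: ch].
have mlh : measurable_fun [set: R] (fun x => l x - h x) by exact: continuous_measurable_fun.
have split_int : (\int[normal_prob 0 1]_x (h x)%:E +
    \int[normal_prob 0 1]_x (l x - h x)%:E = L%:E)%E.
  rewrite -ge0_integralD//.
  - by rewrite -lL; apply: eq_integral => x _; rewrite -EFinD addrC subrK.
  - by move=> x _; rewrite lee_fin.
  - exact/measurable_EFinP.
  - by move=> x _; rewrite lee_fin.
  - exact/measurable_EFinP.
have : (0 <= \int[normal_prob 0 1]_x (h x)%:E)%E.
  by apply: integral_ge0 => x _; rewrite lee_fin.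
have : (0 <= \int[normal_prob 0 1]_x (l x - h x)%:E)%E.
  by apply: integral_ge0 => x _; rewrite lee_fin.
move: split_int.
case hA : (\int[normal_prob 0 1]_x (h x)%:E)%E => [A||] //;
case lhB : (\int[normal_prob 0 1]_x (l x - h x)%:E)%E => [B||] //.
rewrite -EFinD => -[ABL] _ _; exists A => //.
apply/cvgrPdist_le => e e0; have e2 : 0 < e / 2 by rewrite divr_gt0.
near=> n.
have h1 : A - e / 2 <= E n h.
  by near: n; exact: (binomial_clt_liminf ch h0 hA).
have h2 : B - e / 2 <= E n (fun x => l x - h x).
  by near: n; exact: (binomial_clt_liminf clh lh0 lhB).
have h3 : E n l <= L + e / 2 by near: n; apply: (cvgr_le _ El); lra.
rewrite binomial_meanB in h2.
by rewrite ler_norml; apply/andP; split; lra.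
Unshelve. all: by end_near. Qed.

End binomial_clt.

(** * Cox-Ross-Rubinstein prices *)

(** Caratheodory's form of the derivative at 0. It factors every exponential increment without
    division, so that limits reduce to algebra. *)
Lemma expR_sub1_quotient (R : realType) : exists2 Q : R -> R,
  (forall x, expR x - 1 = x * Q x) & Q x @[x --> 0] --> (1:R).
Proof.
have /is_derive1_caratheodory[Q [QE Q0 Q1]] := @is_derive_expR R 0.
rewrite expR0 in Q1; exists Q; last by rewrite -[X in _ --> X]Q1.
by move=> x; rewrite -expR0 QE subr0 mulrC.
Qed.

Definition crr_up (R : realType) (sigma : R) n tau : R :=
  expR (sigma * Num.sqrt (tau / n%:R)).

Definition crr_prob (R : realType) (r sigma : R) n tau : R :=
  (expR (r * tau / n%:R) - (crr_up sigma n tau)^-1) /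
  (crr_up sigma n tau - (crr_up sigma n tau)^-1).

Lemma crr_priceE (R : realType) (f : R -> R) (Z0 r sigma : R) n tau :
  crr_price f Z0 r sigma n tau = (expR (r * tau / n%:R) ^+ n)^-1 *
    binomial_mean (crr_prob r sigma n tau) n (fun k =>
      f (Z0 * crr_up sigma n tau ^+ k * (crr_up sigma n tau)^-1 ^+ (n - k))).
Proof. by []. Qed.

Section crr_prob_bounds.
Variables (R : realType) (r sigma tau : R).
Hypotheses (r0 : 0 <= r) (s0 : 0 < sigma) (t0 : 0 <= tau).

Lemma crr_prob_ge0 n : 0 <= crr_prob r sigma n tau.
Proof.
have x0 : 0 <= sigma * Num.sqrt (tau / n%:R) by rewrite mulr_ge0// ltW.
have d1 : (crr_up sigma n tau)^-1 <= 1.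
  by rewrite -expRN -[leRHS]expR0 ler_expR oppr_le0.
apply: divr_ge0; rewrite subr_ge0 (le_trans d1)//.
- by rewrite -[leLHS]expR0 ler_expR divr_ge0// mulr_ge0.
- by rewrite -[leLHS]expR0 ler_expR.
Qed.

(** The hypothesis, multiplied by [sqrt (tau / n)], says that [R_n <= u_n]. *)
Lemma crr_prob_le1 n : r * Num.sqrt (tau / n%:R) <= sigma ->
  crr_prob r sigma n tau <= 1.
Proof.
move=> rs; have x0 : 0 <= Num.sqrt (tau / n%:R) by [].
have d1 : (crr_up sigma n tau)^-1 <= 1.
  by rewrite -expRN -[leRHS]expR0 ler_expR oppr_le0 mulr_ge0// ltW.
have u1 : 1 <= crr_up sigma n tau.
  by rewrite -[leLHS]expR0 ler_expR mulr_ge0// ltW.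
have : 0 <= crr_up sigma n tau - (crr_up sigma n tau)^-1.
  by rewrite subr_ge0 (le_trans d1).
(* If [u_n = d_n], the quotient is 0 by the convention on division. *)
rewrite le_eqVlt => /predU1P[ud0|ud0].
  by rewrite /crr_prob -ud0 invr0 mulr0.
rewrite ler_pdivrMr// mul1r lerD2r ler_expR.
have -> : r * tau / n%:R = r * Num.sqrt (tau / n%:R) * Num.sqrt (tau / n%:R).
  by rewrite -[RHS]mulrA -expr2 sqr_sqrtr ?mulrA// divr_ge0.
by rewrite ler_wpM2r.
Qed.

End crr_prob_bounds.

Section crr_limit.
Variables (R : realType) (r sigma tau : R).
Hypotheses (r0 : 0 <= r) (s0 : 0 < sigma) (t0 : 0 < tau).

Let drift := (r - sigma ^+ 2 / 2) * tau.
Let vol := sigma * Num.sqrt tau.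

Let st0 : 0 < Num.sqrt tau. Proof. by rewrite sqrtr_gt0. Qed.

Let vol0 : 0 < vol. Proof. by rewrite mulr_gt0. Qed.

Let sqrt_ndiv n : Num.sqrt (tau / n%:R) = Num.sqrt tau * (Num.sqrt n%:R)^-1.
Proof. by rewrite sqrtrM ?ltW// sqrtrV. Qed.

(** With [y = 1 / sqrt n] one has [2 q_n - 1 = (2 R_n - u - 1/u) / (u - 1/u)]. The numerator
    [2 (R_n - 1) - (u - 1)^2 / u] is of order [y^2] and the denominator of order [y]; factoring each
    increment through [Q] gives the ratio of the leading coefficients. *)
Lemma crr_prob_cvg :
  Num.sqrt n%:R * (2 * crr_prob r sigma n tau - 1) @[n --> \oo] --> drift / vol.
Proof.
have [Q QE Q1] := expR_sub1_quotient R.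
pose y n : R := (Num.sqrt n%:R)^-1.
have y0 : y n @[n --> \oo] --> (0:R) by exact: cvg_invr_sqrtn.
have Qlim (a : nat -> R) : a n @[n --> \oo] --> (0:R) ->
    Q (a n) @[n --> \oo] --> (1:R).
  by move=> a0; apply: cvg_comp Q1.
have Elim (a : nat -> R) : a n @[n --> \oo] --> (0:R) ->
    expR (a n) @[n --> \oo] --> (1:R).
  move=> a0; rewrite -(expR0 R); apply: continuous_cvg a0.
  exact: continuous_expR.
have cy c : c * y n @[n --> \oo] --> (0:R).
  by rewrite -(mulr0 c); apply: cvgM y0; exact: cvg_cst.
have cyy c : c * y n * y n @[n --> \oo] --> (0:R).
  by rewrite -(mulr0 0); apply: cvgM y0; exact: cy.
have lim : (2 * (r * tau) * Q (r * tau * y n * y n) -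
      expR (- vol * y n) * (vol * vol) * (Q (vol * y n) * Q (vol * y n))) /
    (expR (- vol * y n) * (2 * vol) * Q (2 * vol * y n)) @[n --> \oo] -->
    (2 * (r * tau) * 1 - 1 * (vol * vol) * (1 * 1)) / (1 * (2 * vol) * 1).
  apply: cvgM; last first.
    apply: cvgV; first by rewrite mul1r mulr1 gt_eqF// mulr_gt0.
    apply: cvgM; last exact/Qlim/cy.
    by apply: cvgM; [exact/Elim/cy|exact: cvg_cst].
  apply: cvgB; first by apply: cvgM; [exact: cvg_cst|exact/Qlim/cyy].
  apply: cvgM; last by apply: cvgM; exact/Qlim/cy.
  by apply: cvgM; [exact/Elim/cy|exact: cvg_cst].
have -> : drift / vol =
    (2 * (r * tau) * 1 - 1 * (vol * vol) * (1 * 1)) / (1 * (2 * vol) * 1).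
  have -> : drift = r * tau - vol * vol / 2.
    have := sqr_sqrtr (ltW t0); rewrite /drift /vol.
    by set t := Num.sqrt tau => <-; field.
  by field; rewrite gt_eqF.
apply: cvg_trans lim; apply: near_eq_cvg; exists 1%N => // n /= n0.
have sn0 : 0 < Num.sqrt n%:R :> R by rewrite sqrtr_gt0 ltr0n.
have yn0 : 0 < y n by rewrite invr_gt0.
have -> : Num.sqrt n%:R = (y n)^-1 by rewrite invrK.
rewrite /crr_prob /crr_up sqrt_ndiv -/(y n).
have -> : sigma * (Num.sqrt tau * y n) = vol * y n by rewrite mulrA.
have -> : r * tau / n%:R = r * tau * y n * y n.
  rewrite -[in RHS]mulrA -expr2 exprVn sqr_sqrtr//.
have := QE (r * tau * y n * y n); have := QE (vol * y n).
have := QE (2 * vol * y n).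
have -> : 2 * vol * y n = vol * y n + vol * y n by ring.
rewrite expRD mulNr expRN.
have up : 1 < expR (vol * y n) by rewrite expR_gt1 mulr_gt0.
set u := expR _ in up *; set v := expR _.
move: (Q _) (Q (_ * y n * y n)) (Q (_ + _)) => Qv Qr Q2.
move=> u2E uE vE.
have uu : 0 < u * u - 1 by nra.
have d0 : u - u^-1 != 0.
  by rewrite gt_eqF// subr_gt0 (lt_trans _ up)// invf_lt1// (lt_trans ltr01).
have u0 : u != 0 by rewrite gt_eqF// (lt_trans ltr01).
have dE : u^-1 * (2 * vol) * Q2 = (u - u^-1) / y n.
  apply: (mulIf (lt0r_neq0 yn0)); rewrite divfK ?gt_eqF//.
  apply: (mulfI u0); rewrite mulrBr divff//.
  by rewrite u2E; field.
rewrite dE.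
have nE : 2 * (r * tau) * Qr - u^-1 * (vol * vol) * (Qv * Qv) =
    (2 * v - u - u^-1) / (y n * y n).
  have -> : 2 * v - u - u^-1 = 2 * (v - 1) - u^-1 * (u - 1) ^+ 2 by field.
  by rewrite uE vE; field; rewrite u0 gt_eqF.
by rewrite nE; field; rewrite u0 !gt_eqF.
Qed.

End crr_limit.

Lemma risk_neutral_mean (R : fieldType) (u d v : R) : u - d != 0 ->
  (v - d) / (u - d) * u + (1 - (v - d) / (u - d)) * d = v.
Proof. by move=> ud; field. Qed.

Section crr_price.
Variables (R : realType) (f : R -> R) (c Z0 r sigma : R).
Hypotheses (cf : continuous f) (f0 : forall x, 0 <= f x).
Hypotheses (c0 : 0 < c) (fc : forall x, f x <= c * `|x|).
Hypotheses (Z00 : 0 < Z0) (r0 : 0 <= r) (s0 : 0 < sigma).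

Lemma crr_price_cvg_pos (tau : R) : 0 < tau ->
  (crr_price f Z0 r sigma n tau)%:E @[n --> \oo] --> bs_price f Z0 r sigma tau.
Proof.
move=> t0; set m := (r - sigma ^+ 2 / 2) * tau; set v := sigma * Num.sqrt tau.
have st0 : 0 < Num.sqrt tau by rewrite sqrtr_gt0.
have v0 : 0 < v by rewrite mulr_gt0.
pose q n := crr_prob r sigma n tau.
pose S x := Z0 * expR (m + v * x).
have S0 x : 0 < S x by rewrite mulr_gt0// expR_gt0.
have cS : continuous S.
  move=> x; apply: cvgM; first exact: cvg_cst.
  apply: continuous_cvg; first exact: continuous_expR.
  apply: cvgD; first exact: cvg_cst.
  by apply: cvgM; [exact: cvg_cst|exact: cvg_id].
(* True as soon as [n >= (r sqrt tau / sigma)^2]. *)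
have q01 : \forall n \near \oo, 0 <= q n <= 1.
  near=> n; apply/andP; split; first by apply: crr_prob_ge0 => //; exact: ltW.
  apply: crr_prob_le1 => //; first exact: ltW.
  rewrite sqrtrM ?(ltW t0)// sqrtrV// mulrA.
  have n0 : 0 < Num.sqrt n%:R :> R.
    by rewrite sqrtr_gt0 ltr0n; near: n; exists 1%N.
  rewrite ler_pdivrMr// [leRHS]mulrC -ler_pdivrMr//.
  have A0 : 0 <= r * Num.sqrt tau / sigma by rewrite divr_ge0 ?mulr_ge0// ltW.
  rewrite -(ger0_norm A0) -sqrtr_sqr ler_wsqrtr//.
  by near: n; exact: nbhs_infty_ger.
(* The tree nodes are values of the limiting stock price [S] at the shifted grid: the shift [m / v]
   cancels the drift [m], and it is the limit [b] found for the weights. *)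
have grid n k : (0 < n)%N -> (k <= n)%N ->
    Z0 * crr_up sigma n tau ^+ k * (crr_up sigma n tau)^-1 ^+ (n - k) =
    S ((2 * k%:R - n%:R) / Num.sqrt n%:R - m / v).
  move=> n0 kn; rewrite /S -mulrA /crr_up -expRN -!expRM_natl -expRD.
  congr (_ * expR _); rewrite natrB// sqrtrM ?ltW// sqrtrV//.
  have sn0 : Num.sqrt n%:R != 0 :> R by rewrite gt_eqF// sqrtr_gt0 ltr0n.
  by rewrite /v; field; rewrite sn0 !gt_eqF.
have mvE : m + v ^+ 2 / 2 = r * tau.
  by rewrite /v exprMn sqr_sqrtr ?ltW// /m; field.
have mexp : measurable_fun [set: R] (fun x => expR (v * x)).
  by apply: measurableT_comp => //; exact: measurable_funM.
have intS : (\int[normal_prob 0 1]_x (c * S x)%:E = (c * Z0 * expR (r * tau))%:E)%E.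
  have -> : (fun x => (c * S x)%:E) =
      (fun x => (c * Z0 * expR m)%:E * (expR (v * x))%:E)%E.
    by apply/funext => x; rewrite -EFinM /S expRD !mulrA.
  rewrite ge0_integralZl_EFin//=.
  - by rewrite integral_normal_prob_expR -EFinM -mvE (expRD m); congr EFin; rewrite mulrA.
  - exact/measurable_EFinP.
  - by rewrite !mulr_ge0 ?expR_ge0// ltW.
have meanS : binomial_mean (q n) n
    (fun k => c * S ((2 * k%:R - n%:R) / Num.sqrt n%:R - m / v)) @[n --> \oo] -->
    c * Z0 * expR (r * tau).
  (* By risk neutrality the mean is the same for every [n >= 1]. *)
  apply: cvg_near_cst; exists 1%N => // n /= n0.
  rewrite (@eq_binomial_mean _ _ _ _ (fun k => c * Z0 *
    (crr_up sigma n tau ^+ k * (crr_up sigma n tau)^-1 ^+ (n - k)))); last first.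
    by move=> k kn; rewrite -grid// !mulrA.
  rewrite binomial_meanZ binomial_mean_expr.
  have -> : q n * crr_up sigma n tau + (1 - q n) * (crr_up sigma n tau)^-1 =
      expR (r * tau / n%:R).
    apply: risk_neutral_mean; rewrite gt_eqF// subr_gt0.
    have u1 : 1 < crr_up sigma n tau.
      by rewrite expR_gt1 mulr_gt0// sqrtr_gt0 divr_gt0// ltr0n.
    by rewrite (lt_trans _ u1)// invf_lt1// expR_gt0.
  rewrite -expRM_natl; congr (_ * expR _).
  by rewrite mulrC divfK// gt_eqF// ltr0n.
have hS : forall x, 0 <= f (S x) <= c * S x.
  by move=> x; rewrite f0/= (le_trans (fc _))// ger0_norm// ltW.
have cfS : continuous (fun x => f (S x)).
  by move=> x; apply: (@continuous_comp _ _ _ S f); [exact: cS|exact: cf].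
have ccS : continuous (fun x => c * S x).
  by move=> x; apply: cvgM; [exact: cvg_cst|exact: cS].
have [A hA EA] := binomial_clt q01 (crr_prob_cvg s0 t0) cfS ccS hS intS meanS.
rewrite /bs_price.
have -> : (\int[normal_prob 0 1]_x (f (Z0 * expR ((r - sigma ^+ 2 / 2) * tau +
    sigma * Num.sqrt tau * x)))%:E = A%:E)%E by [].
rewrite -EFinM; apply: cvg_EFin; first by apply: nearW.
apply: cvg_trans (cvgM (cvg_cst _) EA); apply: near_eq_cvg.
exists 1%N => // n /= n0; rewrite crr_priceE.
rewrite -expRM_natl mulrCA divff ?mulr1; last by rewrite gt_eqF// ltr0n.
rewrite -expRN; congr (_ * _).
by apply: eq_binomial_mean => k kn; rewrite grid.
Unshelve. all: by end_near. Qed.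

(** Maturity 0 must be covered because [S(T)] may vanish. All nodes equal [Z0], and the weights sum
    to 1 whatever the value of [q_n]. *)
Lemma crr_price0 n : crr_price f Z0 r sigma n 0 = f Z0.
Proof.
rewrite crr_priceE /crr_up /crr_prob /crr_up mul0r sqrtr0 !mulr0 mul0r expR0.
rewrite invr1 subrr mul0r expr1n invr1 mul1r.
rewrite (@eq_binomial_mean _ _ _ _ (fun=> f Z0)) ?binomial_mean_cst// => k _.
by rewrite !expr1n !mulr1.
Qed.

Lemma bs_price0 : bs_price f Z0 r sigma 0 = (f Z0)%:E.
Proof.
rewrite /bs_price mulr0 oppr0 expR0 mul1e sqrtr0 !mulr0.
under eq_integral do rewrite mul0r addr0 expR0 mulr1.
by rewrite integral_cst//= probability_setT mule1.
Qed.

Lemma crr_price_cvg (tau : R) : 0 <= tau ->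
  (crr_price f Z0 r sigma n tau)%:E @[n --> \oo] --> bs_price f Z0 r sigma tau.
Proof.
rewrite le_eqVlt => /predU1P[<-|]; last exact: crr_price_cvg_pos.
rewrite bs_price0; apply: cvg_near_cst; apply: nearW => n.
by rewrite crr_price0.
Qed.

Lemma measurable_crr_price n : measurable_fun setT (crr_price f Z0 r sigma n).
Proof.
have mdiv : measurable_fun setT (fun tau : R => tau / n%:R).
  exact: measurable_funM.
have mR : measurable_fun setT (fun tau => expR (r * tau / n%:R)).
  by apply: measurableT_comp => //; apply: measurable_funM => //; exact: measurable_funM.
have msq : measurable_fun setT (fun tau : R => sigma * Num.sqrt (tau / n%:R)).
  apply: measurable_funM => //; apply: measurableT_comp => //.
  by apply: continuous_measurable_fun; exact: sqrt_continuous.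
have mup : measurable_fun setT (crr_up sigma n) by exact: measurableT_comp.
have mdown : measurable_fun setT (fun tau => (crr_up sigma n tau)^-1).
  under eq_fun do rewrite -expRN.
  by apply: measurableT_comp => //; exact: measurableT_comp.
have mq : measurable_fun setT (crr_prob r sigma n).
  (* The reciprocal is written as a power with exponent [-1] of the nonnegative number [u - 1/u],
     which is measurable also where [u = 1/u]. *)
  have -> : crr_prob r sigma n = (fun tau =>
      (expR (r * tau / n%:R) - (crr_up sigma n tau)^-1) *
      (crr_up sigma n tau - (crr_up sigma n tau)^-1) `^ (-1)).
    apply/funext => tau; rewrite powR_inv1// subr_ge0 -expRN ler_expR.
    by rewrite (@le_trans _ _ 0)// ?oppr_le0 mulr_ge0// ltW.
  apply: measurable_funM; first exact: measurable_funB.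
  apply: (measurableT_comp (measurable_powR _)) => //.
  exact: measurable_funB.
have -> : crr_price f Z0 r sigma n = (fun tau => expR (- (n%:R * (r * tau / n%:R))) *
    \sum_(j < n.+1) ('C(n, j))%:R * crr_prob r sigma n tau ^+ j *
      (1 - crr_prob r sigma n tau) ^+ (n - j) *
      f (Z0 * crr_up sigma n tau ^+ j * (crr_up sigma n tau)^-1 ^+ (n - j))).
  by apply/funext => tau; rewrite crr_priceE -expRM_natl expRN.
apply: measurable_funM.
  apply: measurableT_comp => //; apply: measurableT_comp => //.
  by apply: measurable_funM => //; apply: measurable_funM => //; exact: measurable_funM.
apply: measurable_sum => j.
apply: measurable_funM.
  apply: measurable_funM; last by apply: measurable_funX; exact: measurable_funB.
  by apply: measurable_funM => //; exact: measurable_funX.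
apply: measurableT_comp; first exact: continuous_measurable_fun.
apply: measurable_funM; last exact: measurable_funX.
by apply: measurable_funM => //; exact: measurable_funX.
Qed.

(* When [r * sqrt (tau / n) > sigma] the weights [crr_prob] exceed [1], so the
   price is only controlled by the [n]-th power of a constant; but then
   [n < tau * r ^ 2 / sigma ^ 2], whence an exponential in [tau]. *)
Lemma crr_price_bound : exists2 a, 0 <= a & forall n tau, 0 <= tau ->
  `|crr_price f Z0 r sigma n tau| <= c * Z0 * expR (a * tau).
Proof.
(* Bound for [rho] below when [r x > sigma]: then [sigma x > sigma^2 / r], hence
   [u^(-2) < e^(-2 sigma^2 / r)]. For [r = 0] this case does not occur. *)
pose K := 2 / (1 - expR (- 2 * (sigma ^+ 2 / r))).
pose a := Num.max 0 (ln K * (r ^+ 2 / sigma ^+ 2)).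
have a0 : 0 <= a by rewrite le_max lexx.
exists a => // n tau t0.
set x := Num.sqrt (tau / n%:R); have x0 : 0 <= x by exact: sqrtr_ge0.
have x2 : x ^+ 2 = tau / n%:R by rewrite sqr_sqrtr// divr_ge0.
set u := crr_up sigma n tau; set q := crr_prob r sigma n tau.
set v := expR (r * tau / n%:R).
have v0 : 0 < v by exact: expR_gt0.
have u0 : 0 < u by exact: expR_gt0.
have u1 : 1 <= u by rewrite -[leLHS]expR0 ler_expR mulr_ge0// ltW.
have d1 : u^-1 <= 1 by rewrite invf_le1.
have v1 : 1 <= v by rewrite -[leLHS]expR0 ler_expR divr_ge0// mulr_ge0.
have q0 : 0 <= q by rewrite divr_ge0// subr_ge0 (le_trans d1).
(* Discounted one-period growth under the absolute weights; by the binomial theorem its [n]-th power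
   controls the price. For genuine probabilities and [u != 1/u] it equals 1. *)
pose rho := (q * u + `|1 - q| * u^-1) / v.
have rho0 : 0 <= rho.
  apply: divr_ge0; last exact: ltW.
  by rewrite addr_ge0// mulr_ge0// ?invr_ge0 ltW.
have cZ0 : 0 < c * Z0 by rewrite mulr_gt0.
have price_rho : `|crr_price f Z0 r sigma n tau| <= c * Z0 * rho ^+ n.
  have vn0 : 0 < (v ^+ n)^-1 by rewrite invr_gt0 exprn_gt0.
  rewrite crr_priceE -/v -/u -/q normrM (ger0_norm (ltW vn0)).
  rewrite /rho expr_div_n mulrA [leLHS]mulrC ler_pM2r//.
  rewrite addrC exprDn mulr_sumr (le_trans (ler_norm_sum _ _ _))//.
  apply: ler_sum => k _; rewrite !normrM !normrX (ger0_norm q0) normr_nat.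
  rewrite (ger0_norm (f0 _)) -[X in _ <= _ * X]mulr_natr.
  rewrite [(`|1 - q| * _) ^+ _]exprMn [(q * u) ^+ _]exprMn.
  have fS := fc (Z0 * u ^+ k * u^-1 ^+ (n - k)).
  rewrite ger0_norm in fS; last by rewrite !mulr_ge0 ?exprn_ge0 ?invr_ge0// ltW.
  have w0 : 0 <= 'C(n, k)%:R * q ^+ k * `|1 - q| ^+ (n - k).
    by rewrite !mulr_ge0 ?exprn_ge0.
  apply: le_trans (ler_wpM2l w0 fS) _.
  by rewrite le_eqVlt; apply/orP; left; apply/eqP; ring.
rewrite (le_trans price_rho)// ler_pM2l//.
have rho1 : r * x <= sigma -> rho <= 1.
  move=> rxs; have q1 : q <= 1 by exact: crr_prob_le1.
  rewrite /rho ger0_norm ?subr_ge0// ler_pdivrMr// mul1r.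
  have [ud|ud] := eqVneq (u - u^-1) 0.
    by rewrite /q /crr_prob -/u ud invr0 mulr0 mul0r add0r subr0 mul1r (le_trans d1).
  by rewrite /q /crr_prob -/u -/v risk_neutral_mean.
have [/rho1 rho_le1|sxr] := leP (r * x) sigma.
  have rn1 : rho ^+ n <= 1 by rewrite exprn_ile1.
  by rewrite (le_trans rn1)// -expR0 ler_expR mulr_ge0.
have rx0 : 0 < r * x := lt_trans s0 sxr.
have r_gt0 : 0 < r.
  by rewrite lt_neqAle r0 andbT; apply: contraTneq rx0 => <-; rewrite mul0r ltxx.
have x_gt0 : 0 < x by move: rx0; rewrite pmulr_rgt0.
have n0 : 0 < n%:R :> R.
  rewrite lt_neqAle ler0n andbT; apply: contraTneq x_gt0 => n0.
  by rewrite /x -n0 invr0 mulr0 sqrtr0 ltxx.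
have u_gt1 : 1 < u by rewrite expR_gt1 mulr_gt0.
have d_lt1 : u^-1 < 1 by rewrite invf_lt1.
have ud0 : 0 < u - u^-1 by rewrite subr_gt0 (lt_trans d_lt1).
have u2 : u * u - 1 != 0 by rewrite gt_eqF// subr_gt0 mulr_egt1.
have uv : u <= v.
  rewrite ler_expR -/x -[r * tau / _]mulrA -x2 expr2 mulrA ler_wpM2r//.
  exact: ltW.
have e01 : 0 < expR (- 2 * (sigma ^+ 2 / r)) < 1.
  rewrite expR_gt0 expR_lt1 mulNr oppr_lt0 mulr_gt0// divr_gt0// exprn_gt0//.
have eK : 0 < 1 - expR (- 2 * (sigma ^+ 2 / r)) by case/andP: e01 => *; lra.
have K1 : 1 <= K by rewrite /K ler_pdivlMr//; case/andP: e01 => *; lra.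
(* Here [q >= 1], so [rho <= 2 u q / v <= 2 u / (u - 1/u) = 2 / (1 - u^(-2))]. *)
have rhoK : rho <= K.
  have q1 : 1 <= q by rewrite ler_pdivlMr// mul1r lerD2r.
  rewrite /rho distrC ger0_norm ?subr_ge0//.
  have qv : q <= v / (u - u^-1) by rewrite ler_pM2r ?invr_gt0// gerBl invr_ge0 ltW.
  have : q * u + (q - 1) * u^-1 <= 2 * u * q.
    have -> : 2 * u * q = q * u + q * u by ring.
    rewrite lerD2l; apply: ler_pM; rewrite ?subr_ge0 ?invr_ge0 ?gerBl//.
      exact: ltW.
    by rewrite (le_trans d1).
  move=> /le_trans h; rewrite ler_pdivrMr//; apply: h.
  have : 2 * u * q <= 2 * u * (v / (u - u^-1)) by rewrite ler_pM2l// mulr_gt0.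
  move=> /le_trans; apply; rewrite mulrCA mulrC ler_pM2r//.
  have -> : 2 * u / (u - u^-1) = 2 / (1 - u^-1 * u^-1).
    by field; rewrite u2 gt_eqF.
  rewrite ler_pM2l// lef_pV2 ?posrE//; last by rewrite subr_gt0 mulr_ilt1 ?invr_ge0// ltW.
  rewrite lerD2l lerN2 -!expRN -expRD ler_expR -/x.
  have : sigma ^+ 2 / r <= sigma * x.
    by rewrite expr2 -mulrA ler_pM2l// ler_pdivrMr// mulrC ltW.
  lra.
have Kn : rho ^+ n <= K ^+ n by apply: lerXn2r; rewrite ?nnegrE// (le_trans ler01).
rewrite (le_trans Kn)//.
have K0 : 0 < K := lt_le_trans ltr01 K1.
rewrite -[K in K ^+ n]lnK ?posrE// -expRM_natl ler_expR.
have lnK0 : 0 <= ln K by exact: ln_ge0.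
apply: (@le_trans _ _ (ln K * (r ^+ 2 / sigma ^+ 2) * tau)); last first.
  by rewrite ler_wpM2r// /a le_max lexx orbT.
rewrite mulrC -mulrA ler_wpM2l//.
have tauE : tau = n%:R * x ^+ 2 by rewrite x2 mulrC divfK// gt_eqF.
rewrite mulrAC ler_pdivlMr ?exprn_gt0// {1}tauE [leRHS]mulrCA.
by rewrite -[r ^+ 2 * _]exprMn ler_pM2l//; apply: lerXn2r; rewrite ?nnegrE ltW.
Qed.
End crr_price.

(** * Exponential moments of the inverse subordinator *)

Section levy_exponent.
Variables (R : realType) (nu : {measure set R -> \bar R}).
Hypothesis nuP : levy_measure_inf nu.

Let D : set R := `]0, +oo[%classic.

Let mD : measurable D. Proof. exact: measurable_itv. Qed.

Let D_gt0 x : D x -> 0 < x.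
Proof. by rewrite /D/= in_itv/= andbT. Qed.

Let k (u x : R) := 1 - expR (- (u * x)).

Let mk u : measurable_fun D (k u).
Proof.
apply: measurable_funB => //; apply: measurableT_comp => //.
by apply: measurableT_comp => //; exact: measurable_funM.
Qed.

Let k_ge0 u x : 0 <= u -> D x -> 0 <= k u x.
Proof.
move=> u0 /D_gt0 x0; rewrite subr_ge0 -[leRHS]expR0 ler_expR oppr_le0.
by rewrite mulr_ge0// ltW.
Qed.

(** From [1 - e^(-u x) <= (1 + u) min(1, x)] for [x > 0]. Finiteness ensures that [fine] in
    [laplace_exponent] keeps the value of the integral. *)
Lemma laplace_exponent_fin_num u : 0 <= u ->
  (\int[nu]_(x in D) (1 - expR (- (u * x)))%:E)%E \is a fin_num.
Proof.
move=> u0; have [_ fin _] := nuP.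
rewrite ge0_fin_numE; last first.
  by apply: integral_ge0 => x Dx; rewrite lee_fin k_ge0.
have mmin : measurable_fun D (fun x : R => Num.min 1 x).
  exact: measurable_minr.
apply: (@le_lt_trans _ _
    (\int[nu]_(x in D) ((1 + u)%:E * (Num.min 1 x)%:E))%E).
  apply: ge0_le_integral => //.
  - by move=> x Dx; rewrite lee_fin k_ge0.
  - apply/measurable_EFinP; exact: mk.
  - by apply/measurable_EFinP; exact: measurable_funM.
  - move=> x /D_gt0 x0; rewrite -EFinM lee_fin /Num.min.
    have e1 := expR_gt0 (- (u * x)).
    have e2 := expR_ge1Dx (- (u * x)).
    by case: ifPn => _; nra.
rewrite ge0_integralZl_EFin//.
- by rewrite lte_mul_pinfty// lee_fin addr_ge0.
- by move=> x /D_gt0 x0; rewrite lee_fin le_min ler01 ltW.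
- exact/measurable_EFinP.
- by rewrite addr_ge0.
Qed.

(* This is where the infinite activity [nu `]0, +oo[ = +oo] enters. *)
Lemma laplace_exponent_unbounded M :
  exists2 u, 0 <= u & M <= laplace_exponent nu u.
Proof.
have [_ _ infty] := nuP.
(* The integrands increase to 1 on [D], so monotone convergence gives the total mass. *)
have cvg : (\int[nu]_(x in D) (k n%:R x)%:E)%E @[n --> \oo] --> +oo%E.
  rewrite -infty -(mul1e (nu _)) -integral_cst//.
  have klim x : D x -> limn (fun n => (k n%:R x)%:E) = 1%E.
    move=> /D_gt0 x0; apply/cvg_lim => //.
    have e0 : expR (- (n%:R * x)) @[n --> \oo] --> (0:R).
      apply: (cvg_comp (fun n : nat => n%:R * x) (fun y => expR (- y)) _ (@cvgr_expR R)).
      apply/cvgryPge => A; near=> n.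
      by rewrite -ler_pdivrMr//; near: n; exact: nbhs_infty_ger.
    apply: cvg_EFin; first exact: nearW.
    by rewrite -[X in _ --> X]subr0; apply: cvgB e0; exact: cvg_cst.
  rewrite (_ : (\int[nu]_(x in D) cst 1%R%:E x)%E =
    (\int[nu]_(x in D) limn (fun n => (k n%:R x)%:E))%E); last first.
    by apply: eq_integral => x /[!inE] Dx; rewrite klim.
  apply: cvg_monotone_convergence => //.
  - by move=> n; apply/measurable_EFinP; exact: mk.
  - by move=> n x Dx; rewrite lee_fin k_ge0.
  - move=> x /D_gt0 x0 n m nm; rewrite lee_fin lerD2l lerN2 ler_expR lerN2.
    by rewrite ler_pM2r// ler_nat.
move/cvgeyPge : cvg => /(_ M) [n _ /(_ n (leqnn n))] /= Mn.
exists n%:R => //; rewrite -lee_fin /laplace_exponent fineK//.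
exact: laplace_exponent_fin_num.
Unshelve. all: by end_near. Qed.

End levy_exponent.

Section inverse_subordinator.
Variables (R : realType) (d : measure_display) (Omega : measurableType d).
Variables (P : probability Omega R) (nu : {measure set R -> \bar R}).
Variables (U : R -> Omega -> R) (T : R).
Hypotheses (nuP : levy_measure_inf nu) (UP : is_subordinator P nu U).
Hypothesis T0 : 0 < T.

Let S := inverse_subordinator U T.

Let U0 w : U 0 w = 0.
Proof. by have [] := UP. Qed.

Let Und w s t : 0 <= s -> s <= t -> U s w <= U t w.
Proof. by have [_ [h _]] := UP; exact: h. Qed.

Let mU t : 0 <= t -> measurable_fun setT (U t).
Proof. by have [_ [_ [_ [h _]]]] := UP; exact: h. Qed.

Let UE t u : 0 <= t -> 0 <= u ->
  (\int[P]_w (expR (- (u * U t w)))%:E = (expR (- (t * laplace_exponent nu u)))%:E)%E.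
Proof.
move=> t0 u0; have [_ [_ [_ [_ [_ h]]]]] := UP.
rewrite -(h 0 t u)// /Ex; apply: eq_integral => w _.
by rewrite addr0 U0 subr0.
Qed.

Let passed w : set R := [set tau | 0 < tau /\ T < U tau w].

Let passed_lb w : lbound (passed w) 0.
Proof. by move=> tau [/ltW]. Qed.

(* Also when the level [T] is never passed, since then [inf set0 = 0]. *)
Lemma inverse_subordinator_ge0 w : 0 <= S w.
Proof.
rewrite -[S w]/(inf (passed w)).
have [->|/set0P ne] := eqVneq (passed w) set0; first by rewrite inf0.
by apply: lb_le_inf => //; exact: passed_lb.
Qed.

Lemma le_subordinator_before t w : 0 <= t -> t < S w -> U t w <= T.
Proof.
rewrite le_eqVlt => /predU1P[<- _|t0 tS]; first by rewrite U0 ltW.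
rewrite leNgt; apply/negP => TU.
have : S w <= t by apply: ge_inf; [exists 0; exact: passed_lb|split].
by rewrite leNgt tS.
Qed.

(** A countable description of [S < a], for measurability: as paths are monotone, times
    [a - a / (n+2)] suffice to detect a passage before [a], and integer times to detect that there
    is none, in which case [S] is 0. The offset 2 keeps the times positive. *)
Lemma inverse_subordinator_ltP a w : 0 < a ->
  S w < a <-> (exists n : nat, T < U (a - a / n.+2%:R) w) \/ (forall n : nat, U n%:R w <= T).
Proof.
move=> a0; split.
  move=> Sa; have [[tau taup]|no] := pselect (exists tau, passed w tau); last first.
    right=> -[|n]; first by rewrite U0 ltW.
    by rewrite leNgt; apply/negP => TU; apply: no; exists n.+1%:R; split.
  have hinf : has_inf (passed w).
    by split; [exists tau|exists 0; exact: passed_lb].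
  have eps0 : 0 < a - S w by rewrite subr_gt0.
  have [t [t0 TU]] := inf_adherent eps0 hinf.
  rewrite -/(S w) addrC subrK => ta.
  (* This index makes [a / (n+2) <= a - t], so the sampled time is not before [t]. *)
  left; exists (truncn (a / (a - t))).
  have at0 : 0 < a - t by rewrite subr_gt0.
  have /andP[_ h] : (truncn (a / (a - t)))%:R <= a / (a - t) <
    (truncn (a / (a - t))).+1%:R by apply: truncn_itv; rewrite divr_ge0// ltW.
  apply: (lt_le_trans TU); apply: Und; first exact: ltW.
  rewrite lerBrDr -lerBrDl ler_pdivrMr// mulrC -ler_pdivrMr//.
  by rewrite (le_trans (ltW h))// ler_nat.
case=> [[n TU]|never].
  have tau0 : 0 < a - a / n.+2%:R.
    by rewrite subr_gt0 ltr_pdivrMr// ltr_pMr// ltr1n.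
  have : S w <= a - a / n.+2%:R.
    by apply: ge_inf; [exists 0; exact: passed_lb|split].
  by move/le_lt_trans; apply; rewrite ltrBlDr ltrDl divr_gt0.
have p0 : passed w = set0.
  apply/seteqP; split => // tau [tau0 TU] /=.
  have /andP[_ h] : (truncn tau)%:R <= tau < (truncn tau).+1%:R.
    by apply: truncn_itv; exact: ltW.
  have := never (truncn tau).+1.
  rewrite leNgt => /negP; apply; apply: (lt_le_trans TU).
  by apply: Und; exact: ltW.
by rewrite /S /inverse_subordinator -/(passed w) p0 inf0.
Qed.

Lemma measurable_inverse_subordinator : measurable_fun setT S.
Proof.
have mpass t : 0 <= t -> measurable [set w | T < U t w].
  move=> t0; have := mU t0 measurableT (measurable_itv `]T, +oo[).
  rewrite setTI; congr (measurable _).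
  by apply/seteqP; split => w /=; rewrite in_itv/= andbT.
apply: (measurability _ (RGenInftyO.measurableE R)).
move=> _ [_ [a ->] <-]; rewrite setTI.
have [a0|a0] := leP a 0.
  rewrite (_ : _ @^-1` _ = set0)//; apply/seteqP; split => // w /=.
  by rewrite in_itv/= ltNge (le_trans a0)// inverse_subordinator_ge0.
rewrite (_ : _ @^-1` _ = (\bigcup_n [set w | T < U (a - a / n.+2%:R) w]) `|`
    (\bigcap_n ~` [set w | T < U n%:R w])); last first.
  apply/seteqP; split => w /=; rewrite in_itv/=.
    move/(inverse_subordinator_ltP _ a0) => [[n TU]|never]; first by left; exists n.
    by right => n _ /=; apply/negP; rewrite -leNgt.
  case=> [[n _ TU]|never]; apply/(inverse_subordinator_ltP _ a0).
    by left; exists n.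
  by right => n; rewrite leNgt; apply/negP; exact: never.
apply: measurableU; [apply: bigcupT_measurable => n|apply: bigcapT_measurable => n].
- apply: mpass; rewrite subr_ge0 ler_pdivrMr// ler_pMr// ler1n //.
- by apply: measurableC; exact: mpass.
Qed.

(** Pathwise, [e^(a S)] is at most one of the terms [e^(a (j+2)) e^(u (T - U_j))]. Their means form
    a geometric series of ratio [e^(a - psi(u))], which is below 1 once [psi(u) >= a + 1]. *)
Lemma expR_inverse_subordinator_integrable a : 0 <= a ->
  P.-integrable setT (fun w => (expR (a * S w))%:E).
Proof.
move=> a0; have [u u0 au] := laplace_exponent_unbounded nuP (a + 1).
set psi := laplace_exponent nu u in au.
pose term (j : nat) w := expR (a * j.+2%:R + u * T) * expR (- (u * U j%:R w)).
have term0 j w : 0 <= term j w by rewrite mulr_ge0 ?expR_ge0.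
have mterm j : measurable_fun setT (term j).
  apply: measurable_funM => //; apply: measurableT_comp => //.
  apply: measurableT_comp => //; apply: measurable_funM => //.
  exact: mU.
have dom w : ((expR (a * S w))%:E <= \sum_(0 <= j <oo) (term j w)%:E)%E.
  suff [j hj] : exists j, expR (a * S w) <= term j w.
    apply: (@le_trans _ _ (\sum_(0 <= i < j.+1) (term i w)%:E)%E); last first.
      by apply: nneseries_lim_ge => i _ _; rewrite lee_fin.
    rewrite big_nat_recr//= -[leLHS]add0e; apply: leeD.
      by apply: sume_ge0 => i _; rewrite lee_fin.
    by rewrite lee_fin.
  have S0 := inverse_subordinator_ge0 w.
  have /andP[kS Sk] : (truncn (S w))%:R <= S w < (truncn (S w)).+1%:R.
    exact: truncn_itv.
  set m := truncn (S w) in kS Sk.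
  (* The integer part [m] of [S] may equal [S]; its predecessor lies strictly before, so [U <= T]
     there. If [m = 0], the predecessor is 0 and [U_0 = 0]. In both cases [S < m + 1 <= j + 2]. *)
  exists m.-1; rewrite /term -expRD ler_expR -addrA -mulrBr -[leLHS]addr0.
    apply: lerD; last first.
    rewrite mulr_ge0// subr_ge0.
    case: m kS Sk => [|m] mS _; first by rewrite U0 ltW.
    by apply: le_subordinator_before => //; rewrite (lt_le_trans _ mS)// ltr_nat.
  by rewrite ler_wpM2l// (le_trans (ltW Sk))// ler_nat; case: (m).
apply/integrableP; split.
  apply/measurable_EFinP; apply: measurableT_comp => //.
  by apply: measurable_funM => //; exact: measurable_inverse_subordinator.
pose rho := expR (a - psi).
have rho0 : 0 < rho by exact: expR_gt0.
have rho1 : rho < 1 by rewrite expR_lt1; lra.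
pose C := expR (a * 2 + u * T).
have int_term j : (\int[P]_w (term j w)%:E = (C * rho ^+ j)%:E)%E.
  under eq_integral do rewrite EFinM.
  rewrite ge0_integralZl_EFin//.
  - rewrite UE// -EFinM -/psi; congr EFin.
    rewrite /C /rho -expRM_natl -!expRD; congr expR.
    by rewrite -!natr1; ring.
  - apply/measurable_EFinP; apply: measurableT_comp => //.
    apply: measurableT_comp => //; apply: measurable_funM => //; exact: mU.
apply: (@le_lt_trans _ _ (\int[P]_w \sum_(0 <= j <oo) (term j w)%:E)%E).
  apply: ge0_le_integral => //.
  - apply/measurable_EFinP; apply: measurableT_comp => //.
    apply: measurableT_comp => //; apply: measurable_funM => //.
    exact: measurable_inverse_subordinator.
  - apply: ge0_emeasurable_sum => [j w _ _|j _]; first by rewrite lee_fin.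
    exact/measurable_EFinP.
  - by move=> w _; rewrite /= ger0_norm ?expR_ge0.
rewrite integral_nneseries//; last 2 first.
  - by move=> j; exact/measurable_EFinP.
  - by move=> j w _; rewrite lee_fin.
under eq_eseriesr do rewrite int_term.
apply: (@le_lt_trans _ _ (C / (1 - rho))%:E); last exact: ltry.
have C0 : 0 <= C by exact: expR_ge0.
apply: lime_le.
  apply: is_cvg_nneseries => j _ _.
  by rewrite lee_fin mulr_ge0// exprn_ge0// ltW.
apply: nearW => n; rewrite sumEFin lee_fin.
have -> : \sum_(0 <= i < n) C * rho ^+ i = C * (1 - rho ^+ n) / (1 - rho).
  by have := congr1 (fun s => s n) (geometric_seriesE C (negbT (lt_eqF rho1))).
by rewrite ler_pM2r ?invr_gt0 ?subr_gt0// ler_piMr// gerBl exprn_ge0// ltW.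
Qed.

End inverse_subordinator.

(** * Passage to the random maturity *)

Lemma positive_part_continuous (R : realType) (f : R -> R) :
  {within `[0, +oo[%classic, continuous f} ->
  continuous (fun x : R => f (Num.max 0 x)).
Proof.
move=> /subspace_continuousP cf x.
have cmax : {for x, continuous (fun y : R => Num.max 0 y)}.
  by apply: (@continuous_max R R (fun=> 0) id x); [exact: cvg_cst|exact: cvg_id].
have max0 (y : R) : `[0, +oo[%classic (Num.max 0 y).
  by rewrite /= in_itv/= andbT le_max lexx.
apply: (cvg_comp (Num.max (0:R)) f _ (cf _ (max0 x))) => V V0.
have near_x : \forall y \near x, `[0, +oo[%classic (Num.max 0 y) ->
    V (Num.max 0 y) := cmax _ V0.
by apply: filterS near_x => y; apply; exact: max0.
Qed.

Theorem theorem3 (R : realType) (d : measure_display) (Omega : measurableType d)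
  (P : probability Omega R) (nu : {measure set R -> \bar R})
  (U : R -> Omega -> R) (T Z0 r sigma c : R) (f : R -> R) :
  levy_measure_inf nu ->
  is_subordinator P nu U ->
  0 < T -> 0 < Z0 -> 0 <= r -> 0 < sigma ->
  {within `[0, +oo[%classic, continuous f} ->
  (forall x, 0 <= x -> 0 <= f x) ->
  0 < c -> (forall x, 0 <= x -> f x <= c * `|x|) ->
  (fun n : nat =>
     Ex P (fun w => crr_price f Z0 r sigma n (inverse_subordinator U T w)))
    @ \oo -->
  (\int[P]_w bs_price f Z0 r sigma (inverse_subordinator U T w))%E.
Proof.
move=> nuP UP T0 Z00 r0 s0 cf f0 c0 fc.
(* Stock prices are nonnegative, so [f] may be replaced by an extension that is continuous,
   nonnegative and of linear growth on the whole line. *)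
pose g x := f (Num.max 0 x).
have gE x : 0 <= x -> g x = f x by move=> x0; rewrite /g max_r.
have cg : continuous g by exact: positive_part_continuous.
have g0 x : 0 <= g x by rewrite f0// le_max lexx.
have gc x : g x <= c * `|x|.
  rewrite (le_trans (fc _ _)) ?le_max ?lexx// ler_pM2l//.
  rewrite ger0_norm ?le_max ?lexx// ge_max normr_ge0/=; exact: ler_norm.
have -> : crr_price f Z0 r sigma = crr_price g Z0 r sigma.
  apply/funext => n; apply/funext => tau; rewrite !crr_priceE; congr (_ * _).
  apply: eq_binomial_mean => k _; rewrite gE//.
  have u0 : 0 <= crr_up sigma n tau by exact: expR_ge0.
  by rewrite !mulr_ge0 ?exprn_ge0 ?invr_ge0// ltW.
have -> : bs_price f Z0 r sigma = bs_price g Z0 r sigma.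
  apply/funext => tau; rewrite /bs_price; congr (_ * _)%E.
  apply: eq_integral => x _; rewrite gE// mulr_ge0 ?expR_ge0//; exact: ltW.
set S := inverse_subordinator U T.
have S0 w : 0 <= S w by exact: inverse_subordinator_ge0.
have mS : measurable_fun setT S by exact: (measurable_inverse_subordinator UP).
have [a a0 bound] := crr_price_bound g0 c0 gc Z00 r0 s0.
have mV n : measurable_fun setT (fun w => (crr_price g Z0 r sigma n (S w))%:E).
  apply/measurable_EFinP; apply: measurableT_comp mS.
  exact: measurable_crr_price.
have cvgV w : (crr_price g Z0 r sigma n (S w))%:E @[n --> \oo] -->
    bs_price g Z0 r sigma (S w).
  exact: (crr_price_cvg cg g0 c0 gc Z00 r0 s0 (S0 w)).
(* Inherited from the tree prices as their pointwise limit. *)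
have mbs : measurable_fun setT (fun w => bs_price g Z0 r sigma (S w)).
  by apply: emeasurable_fun_cvg mV _ => w _; exact: cvgV.
have dom_int : P.-integrable setT (fun w => (c * Z0 * expR (a * S w))%:E).
  rewrite (_ : (fun w => _) = fun w => ((c * Z0)%:E * (expR (a * S w))%:E)%E)//.
  apply: integrableZl => //; exact: (expR_inverse_subordinator_integrable nuP UP).
have [] := @dominated_convergence _ _ _ P setT measurableT _ _ _ mV mbs _ dom_int _.
- by apply: aeW => w _; exact: cvgV.
- by apply: aeW => w n _; rewrite lee_fin; exact: bound.
- by [].
Qed.
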